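(* Suppose that $V \subseteq M_{m,n}(\mathbb{K})$ is a linear subspace spanned by a basis $M_1,\ldots,M_p$ (the ''hidden basis'') such that the linear spaces $\operatorname{Im}(M_1),\ldots,\operatorname{Im}(M_p)$ are in direct sum and the linear spaces $\operatorname{Im}(M_1^T),\ldots,\operatorname{Im}(M_p^T)$ are also in direct sum. There is a randomized polynomial-time algorithm which, given as input any basis $Z_1,\ldots,Z_p$ of $V$, correctly finds the hidden basis (up to scaling and permutation) and outputs $\rho=\min_{M \in V, M\neq 0} \operatorname{rank} M$ together with matrices $A_1,\dots,A_s$ which are, up to scalar multiplication, the only matrices of rank $\rho$ in $V$. Moreover, the matrices $A_1,\dots,A_s$ are a subset of the hidden basis.
   Context: The algorithm performs arithmetic over $\mathbb{K}$ and is assumed to have access to a procedure computing the roots in $\mathbb{K}$ of univariate polynomials with coefficients in $\mathbb{K}$. *)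

(* Defs.v *)
From mathcomp Require Import all_boot all_order all_algebra all_fingroup.

Set Implicit Arguments.
Unset Strict Implicit.
Unset Printing Implicit Defensive.

Import GRing.Theory.
Local Open Scope ring_scope.

(******************************************************************************)
(* Model of computation.  Randomized algorithms over a field K are programs   *)
(* of a small imperative language acting on                                   *)
(*   - integer arrays, x[i], where x is a fixed name (a scalar is x[0]);      *)
(*   - arrays of elements of K with three indices, x[i, j, k].                *)
(* Programs do not mention K: the same text runs over every field, and the    *)
(* elements of K can only be combined by field operations, compared, and      *)
(* passed to the root-finding procedure.  Field operations, comparisons and   *)
(* coin flips have unit cost.  An integer operation is charged the bit length *)
(* of its result (logarithmic cost), so that a polynomial running time also   *)
(* bounds polynomially the size of all integers.  The only loops are          *)
(* bounded ones, so every program terminates; no generality is lost for       *)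
(* polynomial-time algorithms, which can be run under a clock.                *)
(******************************************************************************)

Inductive nexp : Type :=
  | NCst of nat
  | NGet of nat & nexp
  | NAdd of nexp & nexp
  | NSub of nexp & nexp
  | NMul of nexp & nexp.

Inductive fexp : Type :=
  | FCst of nat                             (* the element n%:R of K *)
  | FGet of nat & nexp & nexp & nexp
  | FAdd of fexp & fexp
  | FOpp of fexp
  | FMul of fexp & fexp
  | FInv of fexp.

Inductive bexp : Type :=
  | BLeq of nexp & nexp
  | BFEq of fexp & fexp
  | BNot of bexp
  | BAnd of bexp & bexp.

Inductive cmd : Type :=
  | CSkip
  | CNSet of nat & nexp & nexp              (* x[i] := e *)
  | CFSet of nat & nexp & nexp & nexp & fexp (* x[i, j, k] := e *)
  | CFlip of nat                            (* x[0] := uniform random bit *)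
  (* CRoots x g f d: computes the roots in K of the polynomial              *)
  (* f[0,0,0] + f[0,0,1] X + ... + f[0,0,d-1] X^(d-1), stores them in       *)
  (* g[0,0,0], g[0,0,1], ..., and stores their number in x[0].              *)
  | CRoots of nat & nat & nat & nexp
  | CSeq of cmd & cmd
  | CIf of bexp & cmd & cmd
  | CFor of nat & nexp & cmd.               (* for x[0] = 0, ..., e - 1 do c *)

(* An answer of the root-finding procedure lists the distinct roots, in an    *)
(* unspecified order; by convention it is empty for the zero polynomial.      *)
Definition root_finder (K : fieldType) (rt : {poly K} -> seq K) : Prop :=
  forall P : {poly K}, uniq (rt P) /\
    forall x : K, (x \in rt P) = (P != 0) && root P x.

Record state (K : fieldType) : Type := State {
  ints  : nat -> nat -> nat;
  flds  : nat -> nat -> nat -> nat -> K;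
  coins : seq bool;                         (* random bits not yet used *)
  clock : nat                               (* time spent so far *)
}.

Section Semantics.
Variable K : fieldType.
Implicit Types s : state K.

Definition tick (t : nat) s : state K :=
  State (ints s) (flds s) (coins s) (clock s + t).

Definition set_int (x i v : nat) s : state K :=
  State (fun y j => if (y == x) && (j == i) then v else ints s y j)
        (flds s) (coins s) (clock s).

Definition set_fld (x i j k : nat) (v : K) s : state K :=
  State (ints s)
        (fun y i' j' k' => if [&& y == x, i' == i, j' == j & k' == k] then v
                           else flds s y i' j' k')
        (coins s) (clock s).

Definition set_list (x : nat) (r : seq K) s : state K :=
  State (ints s)
        (fun y i j k => if [&& y == x, i == 0, j == 0 & k < size r]%N
                        then nth 0 r k else flds s y i j k)
        (coins s) (clock s).

Fixpoint neval s (e : nexp) : nat :=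
  match e with
  | NCst n => n
  | NGet x i => ints s x (neval s i)
  | NAdd a b => (neval s a + neval s b)%N
  | NSub a b => (neval s a - neval s b)%N
  | NMul a b => (neval s a * neval s b)%N
  end.

Definition bitcost (n : nat) : nat := (trunc_log 2 n).+1.

Fixpoint ncost s (e : nexp) : nat :=
  match e with
  | NCst n => 1
  | NGet x i => (ncost s i).+1
  | NAdd a b | NSub a b | NMul a b =>
      (ncost s a + ncost s b + bitcost (neval s e))%N
  end.

Fixpoint feval s (e : fexp) : K :=
  match e with
  | FCst n => n%:R
  | FGet x i j k => flds s x (neval s i) (neval s j) (neval s k)
  | FAdd a b => feval s a + feval s b
  | FOpp a => - feval s a
  | FMul a b => feval s a * feval s b
  | FInv a => (feval s a)^-1
  end.

Fixpoint fcost s (e : fexp) : nat :=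
  match e with
  | FCst n => 1
  | FGet x i j k => (ncost s i + ncost s j + ncost s k).+1
  | FAdd a b | FMul a b => (fcost s a + fcost s b).+1
  | FOpp a | FInv a => (fcost s a).+1
  end.

Fixpoint beval s (e : bexp) : bool :=
  match e with
  | BLeq a b => (neval s a <= neval s b)%N
  | BFEq a b => feval s a == feval s b
  | BNot a => ~~ beval s a
  | BAnd a b => beval s a && beval s b
  end.

Fixpoint bcost s (e : bexp) : nat :=
  match e with
  | BLeq a b => (ncost s a + ncost s b).+1
  | BFEq a b => (fcost s a + fcost s b).+1
  | BNot a => (bcost s a).+1
  | BAnd a b => (bcost s a + bcost s b).+1
  end.

Variable rt : {poly K} -> seq K.

Fixpoint exec (c : cmd) s : state K :=
  match c with
  | CSkip => tick 1 s
  | CNSet x i e =>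
      tick (ncost s i + ncost s e).+1 (set_int x (neval s i) (neval s e) s)
  | CFSet x i j k e =>
      tick (ncost s i + ncost s j + ncost s k + fcost s e).+1
        (set_fld x (neval s i) (neval s j) (neval s k) (feval s e) s)
  | CFlip x =>
      let s' := set_int x 0 (head false (coins s)) s in
      tick 1 (State (ints s') (flds s') (behead (coins s')) (clock s'))
  | CRoots x g f d =>
      let r := rt (\poly_(i < neval s d) flds s f 0 0 i) in
      tick (ncost s d + neval s d).+1 (set_list g r (set_int x 0 (size r) s))
  | CSeq c1 c2 => exec c2 (exec c1 s)
  | CIf b c1 c2 =>
      let s' := tick (bcost s b).+1 s in
      if beval s b then exec c1 s' else exec c2 s'
  | CFor x e c1 =>
      foldl (fun s' t => exec c1 (tick 1 (set_int x 0 t s')))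
            (tick (ncost s e).+1 s) (iota 0 (neval s e))
  end.

End Semantics.

(* Input: m, n, p in the scalars 0, 1, 2, and the (i, j) entry of the k-th    *)
(* matrix in cell [k, i, j] of array 0; every other cell is 0.                *)
Definition input (K : fieldType) (m n p : nat) (Z : p.-tuple 'M[K]_(m, n))
    (w : seq bool) : state K :=
  State
    (fun x i => if i == 0%N then nth 0%N [:: m; n; p] x else 0%N)
    (fun x k i j =>
       match (insub k : option 'I_p), (insub i : option 'I_m),
             (insub j : option 'I_n) with
       | Some k', Some i', Some j' => if x == 0%N then tnth Z k' i' j' else 0
       | _, _, _ => 0
       end)
    w 0.

Definition read_mx (K : fieldType) (m n : nat) (s : state K) (x k : nat) :
    'M[K]_(m, n) := \matrix_(i, j) flds s x k i j.

(* Output: rho and the number of matrices of rank rho in the scalars 0 and 1, *)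
(* the hidden basis in array 1, the matrices of rank rho in array 2.          *)
Definition out_rho (K : fieldType) (s : state K) : nat := ints s 0 0.
Definition out_num (K : fieldType) (s : state K) : nat := ints s 1 0.
Definition out_basis (K : fieldType) (m n p : nat) (s : state K) (k : 'I_p) :
  'M[K]_(m, n) := read_mx m n s 1 k.
Definition out_minrank (K : fieldType) (m n : nat) (s : state K)
  (l : 'I_(out_num s)) : 'M[K]_(m, n) := read_mx m n s 2 l.

(* The column space of A, as the image of the linear map u |-> A u.           *)
Definition Im (K : fieldType) (m n : nat) (A : 'M[K]_(m, n)) :
  {vspace 'cV[K]_m} := limg (linfun (mulmx A : 'cV[K]_n -> 'cV[K]_m)).

Definition is_min_rank (K : fieldType) (m n : nat) (V : {vspace 'M[K]_(m, n)})
    (rho : nat) : Prop :=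
  (exists X : 'M[K]_(m, n), [/\ X \in V, X != 0 & \rank X = rho]) /\
  (forall X : 'M[K]_(m, n), X \in V -> X != 0 -> (rho <= \rank X)%N).

Definition correct_output (K : fieldType) (m n p : nat)
    (V : {vspace 'M[K]_(m, n)}) (M : p.-tuple 'M[K]_(m, n)) (s : state K) :
    Prop :=
  [/\ exists sigma : 'S_p, forall k : 'I_p,
        exists2 a : K, a != 0 & out_basis m n s k = a *: tnth M (sigma k),
      is_min_rank V (out_rho s),
      forall X : 'M[K]_(m, n), X \in V ->
        (\rank X = out_rho s <->
         exists l : 'I_(out_num s),
           exists2 a : K, a != 0 & X = a *: out_minrank m n l)
    & exists2 g : 'I_(out_num s) -> 'I_p, injective g &
        forall l, out_minrank m n l = out_basis m n s (g l)].

(* The event E has probability at least q when the N bits are independent and *)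
(* uniform; the set G only avoids assuming that E is decidable.               *)
Definition prob_ge (N : nat) (q : rat) (E : N.-tuple bool -> Prop) : Prop :=
  exists2 G : {set N.-tuple bool},
    (q <= #|G|%:R / (2 ^ N)%:R)%R & forall w, w \in G -> E w.

(* Main.v *)
(* The algorithm is deterministic and works over every field.  A matrix c acts
   on V by Z_k |-> sum_l c_kl Z_l.  Requiring that every linear relation
   sum_k Z_k x_k = 0 between the columns of the Z_k remain one after this
   substitution is a linear system in c, and the two direct sum hypotheses make
   its solutions exactly the maps that are diagonal in the hidden basis: the
   column spaces being independent, a relation splits into M_i y_i = 0 for each
   i, and the row spaces being independent, ker M_h is not contained in ker M_i
   for h <> i.  The solutions form an algebra isomorphic to K^p.  Its primitive
   idempotents, which are the projections onto the lines K M_i, are found one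
   after the other: starting from the complement W of those already found,
   replace W by (C - l) W whenever this is nonzero, for C in a basis of the
   algebra and l a root of a polynomial that annihilates C.  In the end W meets
   a single eigenspace of each C, hence is a multiple of a primitive idempotent,
   which dividing by the trace makes exact.  Finally, if a_i <> 0 then
   sum_k a_k M_k has rank at least that of M_i, with equality only if it is
   a_i M_i, so the matrices of minimal rank are the hidden ones of that rank. *)
Require Import Defs.
From mathcomp Require Import all_boot all_order all_algebra all_fingroup.

Set Implicit Arguments.
Unset Strict Implicit.
Unset Printing Implicit Defensive.

Import GRing.Theory.
Local Open Scope ring_scope.

(** * Effect of programs *)

Arguments exec : simpl never.

(** The eigenvalues all lie in K because the algebra is K^p, hence root finding inside K loses none
    of them. All linear algebra goes through one solver for homogeneous systems. It serves for the
    relations, for the algebra, for annihilating polynomials (linear relations between 1, C, ...,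
    C^p) and for ranks (the number of independent equations). It keeps a spanning family of constant
    size rather than a basis, so rows are never reordered or removed; the generators [G] of the
    algebra may thus be redundant, or zero. Running time is made a syntactic matter: (m + n + p +
    1)^2 is computed once, and sums and products stored later are truncated at this value. Integers,
    and with them loop lengths, then stay bounded. *)

Fixpoint nreads (e : nexp) : seq nat :=
  match e with
  | NCst _ => [::]
  | NGet x i => x :: nreads i
  | NAdd a b | NSub a b | NMul a b => nreads a ++ nreads b
  end.

Fixpoint freads (e : fexp) : seq nat :=
  match e with
  | FCst _ => [::]
  | FGet x _ _ _ => [:: x]
  | FAdd a b | FMul a b => freads a ++ freads b
  | FOpp a | FInv a => freads a
  end.

Fixpoint iwrites (c : cmd) : seq nat :=
  match c with
  | CSkip | CFSet _ _ _ _ _ => [::]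
  | CNSet x _ _ | CFlip x | CRoots x _ _ _ => [:: x]
  | CSeq a b | CIf _ a b => iwrites a ++ iwrites b
  | CFor x _ a => x :: iwrites a
  end.

Fixpoint fwrites (c : cmd) : seq nat :=
  match c with
  | CSkip | CNSet _ _ _ | CFlip _ => [::]
  | CFSet x _ _ _ _ | CRoots _ x _ _ => [:: x]
  | CSeq a b | CIf _ a b => fwrites a ++ fwrites b
  | CFor _ _ a => fwrites a
  end.

Notation nvar x := (NGet x (NCst 0)).

Section Framework.
Variables (K : fieldType) (rt : {poly K} -> seq K).
Implicit Types (s : state K) (c : cmd).

(** Frame condition: [wi] and [wf] list the arrays that may change. Clock and coins are left free,
    so ticks are invisible to it. *)
Definition same (wi wf : seq nat) s s' : Prop :=
  (forall x i, x \notin wi -> ints s' x i = ints s x i) /\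
  (forall x i j k, x \notin wf -> flds s' x i j k = flds s x i j k).

Lemma neval_ext s s' e :
  (forall x i, x \in nreads e -> ints s x i = ints s' x i) ->
  neval s e = neval s' e.
Proof.
elim: e => //= [x e IH|a IHa b IHb|a IHa b IHb|a IHa b IHb] H.
- rewrite IH => [|y i yin]; first by rewrite H ?mem_head.
  by rewrite H // inE yin orbT.
all: by rewrite IHa 1?IHb // => x i xin; rewrite H // mem_cat xin ?orbT.
Qed.

Lemma feval_ext s s' e :
  (forall x i, ints s x i = ints s' x i) ->
  (forall x i j k, x \in freads e -> flds s x i j k = flds s' x i j k) ->
  feval s e = feval s' e.
Proof.
move=> HI; have HN e' : neval s e' = neval s' e' by apply: neval_ext.
elim: e => //= [x i j k|a IHa b IHb|a IHa|a IHa b IHb|a IHa] H.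
- by rewrite !HN H ?mem_head.
- by rewrite IHa 1?IHb // => x i j k xin; rewrite H // mem_cat xin ?orbT.
- by rewrite IHa.
- by rewrite IHa 1?IHb // => x i j k xin; rewrite H // mem_cat xin ?orbT.
- by rewrite IHa.
Qed.

Lemma exec_seq c1 c2 s : exec rt (CSeq c1 c2) s = exec rt c2 (exec rt c1 s).
Proof. by []. Qed.

Lemma exec_if b c1 c2 s : exec rt (CIf b c1 c2) s =
  if beval s b then exec rt c1 (tick (bcost s b).+1 s)
  else exec rt c2 (tick (bcost s b).+1 s).
Proof. by []. Qed.

(** Invariant rule. The bound is evaluated once, before the loop, and the counter is rewritten at
    each pass, so [I] carries the pass number itself. *)
Lemma exec_for (I : nat -> state K -> Prop) x e c s :
  I 0%N (tick (ncost s e).+1 s) ->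
  (forall t s', (t < neval s e)%N -> I t s' ->
     I t.+1 (exec rt c (tick 1 (set_int x 0 t s')))) ->
  I (neval s e) (exec rt (CFor x e c) s).
Proof.
rewrite /exec -/exec; move: (neval s e) => N I0 IS.
suff H t : (t <= N)%N -> I t (foldl (fun s' t => exec rt c (tick 1 (set_int x 0 t s')))
  (tick (ncost s e).+1 s) (iota 0 t)) by apply: H.
elim: t => // t IH lt; rewrite -addn1 iotaD foldl_cat /= add0n addn1.
by apply: IS => //; apply: IH; apply: ltnW.
Qed.

Lemma same_trans wi wf s1 s2 s3 :
  same wi wf s1 s2 -> same wi wf s2 s3 -> same wi wf s1 s3.
Proof.
move=> [a b] [c d]; split => *; first by rewrite c // a.
by rewrite d // b.
Qed.

Lemma same_sub wi wf wi' wf' s s' :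
  {subset wi <= wi'} -> {subset wf <= wf'} -> same wi wf s s' -> same wi' wf' s s'.
Proof.
move=> si sf [a b]; split => [x i nx|x i j k nx].
  by apply: a; apply: contra nx; apply: si.
by apply: b; apply: contra nx; apply: sf.
Qed.

Lemma exec_same c s : same (iwrites c) (fwrites c) s (exec rt c s).
Proof.
elim: c s => [|x i e|x i j k e|x|x g f d|a IHa b IHb|b a1 IH1 a2 IH2|x e a IHa] s.
- by split.
- split=> // y j; rewrite inE /= => /negbTE /= ->; by [].
- split=> // y i' j' k'; rewrite inE /= => /negbTE /= ->; by [].
- split=> // y j; rewrite inE /= => /negbTE /= ->; by [].
- split=> [y j|y i j k]; rewrite inE /= => /negbTE /= ->; by [].
- rewrite exec_seq; apply: same_trans (same_sub _ _ (IHa s)) (same_sub _ _ (IHb _)) => //= z;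
    by rewrite mem_cat => ->; rewrite ?orbT.
- rewrite /exec -/exec; case: (beval s b).
    by apply: same_sub (IH1 (tick _ s)) => z /=; rewrite mem_cat => ->.
  by apply: same_sub (IH2 (tick _ s)) => z /=; rewrite mem_cat => ->; rewrite orbT.
- apply: (@exec_for (fun _ => same _ _ s)) => // t s' _ H; apply: same_trans H _.
  apply: same_trans (same_sub _ _ (IHa _)) => //; last by move=> y; rewrite inE => ->; rewrite orbT.
  by split=> // y j; rewrite inE /= negb_or => /andP[/negbTE /= -> _].
Qed.

Lemma exec_ints c s x i :
  x \notin iwrites c -> ints (exec rt c s) x i = ints s x i.
Proof. by case: (exec_same c s) => H _; apply: H. Qed.

Lemma exec_flds c s x i j k :
  x \notin fwrites c -> flds (exec rt c s) x i j k = flds s x i j k.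
Proof. by case: (exec_same c s) => _ H; apply: H. Qed.

End Framework.

(** * Filling an array with sums, by nested loops *)

Notation vr := 10%N (only parsing).
Notation vu := 11%N (only parsing).
Notation vv := 12%N (only parsing).
Notation vz := 13%N (only parsing).
Notation aACC := 10%N (only parsing).

(** The cell [[eb + r, u, v]] receives the sum of [body] over z < [ew]. Copies ([ew] = 1), matrix
    products, traces and pairings are all instances. *)
Definition tset (arr : nat) (eb er eu ev ew : nexp) (body : fexp) : cmd :=
  CFor vr er (CFor vu eu (CFor vv ev
    (CSeq (CFSet aACC (NCst 0) (NCst 0) (NCst 0) (FCst 0))
    (CSeq (CFor vz ew (CFSet aACC (NCst 0) (NCst 0) (NCst 0)
                 (FAdd (FGet aACC (NCst 0) (NCst 0) (NCst 0)) body)))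
      (CFSet arr (NAdd eb (nvar vr)) (nvar vu) (nvar vv)
         (FGet aACC (NCst 0) (NCst 0) (NCst 0))))))).

(** An idealised state for evaluating the body: current counters, but the field arrays as they were
    before the assignment began. *)
Definition loopst (K : fieldType) (s : state K) (r u v z : nat) : state K :=
  set_int vz 0 z (set_int vv 0 v (set_int vu 0 u (set_int vr 0 r s))).

Section Tset.
Variables (K : fieldType) (rt : {poly K} -> seq K).
Variables (arr : nat) (eb er eu ev ew : nexp) (body : fexp).
Hypothesis arr_acc : arr != aACC.
Hypothesis body_acc : aACC \notin freads body.
Hypothesis body_arr : arr \notin freads body.
Let loopfree e := all (fun x => x \notin [:: vr; vu; vv; vz]) (nreads e).
Hypothesis eb_ok : loopfree eb.
Hypothesis eu_ok : loopfree eu.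
Hypothesis ev_ok : loopfree ev.
Hypothesis ew_ok : loopfree ew.

Definition ieq (L : seq (nat * nat)) (s s' : state K) : Prop :=
  forall x i, (x, i) \notin L -> ints s' x i = ints s x i.

Lemma neval_ieq s s' L e : ieq L s s' ->
  all (fun q => q.1 \in [:: vr; vu; vv; vz]) L -> loopfree e ->
  neval s' e = neval s e.
Proof.
move=> h /allP hL /allP he; apply: neval_ext => x i /he hx; apply: h.
by apply: contra hx => /hL.
Qed.

Let cell :=
    (CSeq (CFSet aACC (NCst 0) (NCst 0) (NCst 0) (FCst 0))
    (CSeq (CFor vz ew (CFSet aACC (NCst 0) (NCst 0) (NCst 0)
                 (FAdd (FGet aACC (NCst 0) (NCst 0) (NCst 0)) body)))
      (CFSet arr (NAdd eb (nvar vr)) (nvar vu) (nvar vv)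
         (FGet aACC (NCst 0) (NCst 0) (NCst 0))))).

Variable s : state K.

Let S r u v := \sum_(z < neval s ew) feval (loopst s r u v z) body.
Let b := neval s eb.
Let foff s' := forall x i j k, x \notin [:: arr; aACC] -> flds s' x i j k = flds s x i j k.

(** The loops are peeled from the inside out, each lemma freeing one more counter in [ieq]. As
    [body] reads neither [arr] nor [aACC], its value is always the one in the initial arrays. *)
Lemma tset_cell r u v s0 :
  ieq [:: (vz, 0%N)] (set_int vv 0 v (set_int vu 0 u (set_int vr 0 r s))) s0 ->
  foff s0 ->
  let s' := exec rt cell s0 in
  [/\ ieq [:: (vz, 0%N)] s0 s', foff s' &
    forall k u' v', flds s' arr k u' v' =
      if [&& k == b + r, u' == u & v' == v]%N then S r u v else flds s0 arr k u' v'].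
Proof.
move=> hi hf; rewrite /cell !exec_seq.
set s1 := exec rt (CFSet _ _ _ _ _) s0.
set c := CFSet aACC _ _ _ (FAdd _ _).
have e1 e : loopfree e -> neval s0 e = neval s e.
  move=> he; rewrite (neval_ieq hi) //.
  have h : ieq [:: (vv,0);(vu,0);(vr,0)]%N s
             (set_int vv 0 v (set_int vu 0 u (set_int vr 0 r s))).
    move=> x i; rewrite !inE !negb_or !xpair_eqE /= => /and3P[].
    by do 3!move/negbTE->.
  by rewrite (neval_ieq h).
pose I t st := [/\ ieq [:: (vz, 0%N)] s0 st,
   forall x i j k, x != aACC -> flds st x i j k = flds s0 x i j k &
   flds st aACC 0 0 0 = \sum_(z < t) feval (loopst s r u v z) body].
have e2 : neval s1 ew = neval s ew.
  by rewrite -(e1 _ ew_ok); apply: neval_ext.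
have : I (neval s1 ew) (exec rt (CFor vz ew c) s1).
  apply: exec_for => [|t st _ [i1 i2 i3]].
    split=> //; last by rewrite big_ord0.
    by move=> x i j k /negbTE h; rewrite /= h.
  have hb : feval (tick 1 (set_int vz 0 t st)) body = feval (loopst s r u v t) body.
    apply: feval_ext => [x i|x i j k xin].
      rewrite /loopst /=; case E: ((x == vz) && (i == 0%N)) => //.
      have xi : (x, i) \notin [:: (vz, 0%N)] by rewrite inE xpair_eqE /= E.
      by rewrite i1 // hi.
    have xa : x != aACC by apply: contraNneq body_acc => <-.
    rewrite [LHS]i2 // hf // !inE negb_or xa andbT.
    by apply: contraNneq body_arr => <-.
  split.
  - move=> x i xi; rewrite -i1 //= ; move: xi; rewrite inE xpair_eqE => /negbTE -> //.
  - by move=> x i j k h; rewrite -i2 //= (negbTE h).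
  - by rewrite big_ord_recr /= hb i3.
rewrite e2; set s2 := exec rt (CFor _ _ _) s1.
case=> i1 i2 i3.
have hb : neval s2 eb = b by rewrite (neval_ieq i1) // e1.
have hr : ints s2 vr 0 = r by rewrite i1 // hi.
have hu : ints s2 vu 0 = u by rewrite i1 // hi.
have hv : ints s2 vv 0 = v by rewrite i1 // hi.
split=> //.
- move=> x i j k; rewrite !inE negb_or => /andP[x1 x2].
  by rewrite exec_flds ?inE // i2 // hf // !inE negb_or x1 x2.
- move=> k u' v'; rewrite /exec /= hb hr hu hv eqxx /=.
  by case: ifP => // _; rewrite i2.
Qed.

Lemma tset_vloop r u s0 :
  ieq [:: (vv, 0%N); (vz, 0%N)] (set_int vu 0 u (set_int vr 0 r s)) s0 ->
  foff s0 ->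
  let s' := exec rt (CFor vv ev cell) s0 in
  [/\ ieq [:: (vv, 0%N); (vz, 0%N)] s0 s', foff s' &
    forall k u' v', flds s' arr k u' v' =
      if [&& k == b + r, u' == u & v' < neval s ev]%N then S r u v' else flds s0 arr k u' v'].
Proof.
move=> hi hf /=.
have <- : neval s0 ev = neval s ev.
  rewrite (neval_ieq hi) //.
  have h : ieq [:: (vu,0);(vr,0)]%N s (set_int vu 0 u (set_int vr 0 r s)).
    move=> x i; rewrite !inE !negb_or !xpair_eqE /= => /andP[].
    by do 2!move/negbTE->.
  by rewrite (neval_ieq h).
pose I t st := [/\ ieq [:: (vv, 0%N); (vz, 0%N)] s0 st, foff st &
    forall k u' v', flds st arr k u' v' =
      if [&& k == b + r, u' == u & v' < t]%N then S r u v' else flds s0 arr k u' v'].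
apply: (@exec_for _ rt I) => [|t st _ [i1 i2 i3]].
  by split=> // k u' v'; rewrite ltn0 !andbF.
have [||j1 j2 j3] := @tset_cell r u t (tick 1 (set_int vv 0 t st)).
  move=> x i; rewrite inE xpair_eqE => xi.
  rewrite /=; case E: ((x == vv) && (i == 0%N)) => //.
  have xi' : (x, i) \notin [:: (vv, 0%N); (vz, 0%N)].
    by rewrite !inE !xpair_eqE E.
  by rewrite i1 // hi.
  exact: i2.
split=> //.
- move=> x i xi; rewrite -i1 // j1 /=; first by move: xi; rewrite !inE !xpair_eqE negb_or => /andP[/negbTE ->].
  by move: xi; rewrite !inE !xpair_eqE negb_or => /andP[].
- move=> k u' v'; rewrite j3 /= i3 [in RHS]ltnS [in RHS]leq_eqVlt.
  case: (k == _) => //=; case: (u' == u) => //=.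
  by case: eqP => [->|].
Qed.

Lemma tset_uloop r s0 :
  ieq [:: (vu, 0%N); (vv, 0%N); (vz, 0%N)] (set_int vr 0 r s) s0 ->
  foff s0 ->
  let s' := exec rt (CFor vu eu (CFor vv ev cell)) s0 in
  [/\ ieq [:: (vu, 0%N); (vv, 0%N); (vz, 0%N)] s0 s', foff s' &
    forall k u' v', flds s' arr k u' v' =
      if [&& k == b + r, u' < neval s eu & v' < neval s ev]%N then S r u' v' else flds s0 arr k u' v'].
Proof.
move=> hi hf /=.
have <- : neval s0 eu = neval s eu.
  rewrite (neval_ieq hi) //.
  have h : ieq [:: (vr,0)]%N s (set_int vr 0 r s).
    by move=> x i; rewrite !inE !xpair_eqE /= => /negbTE->.
  by rewrite (neval_ieq h).
pose I t st := [/\ ieq [:: (vu, 0%N); (vv, 0%N); (vz, 0%N)] s0 st, foff st &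
    forall k u' v', flds st arr k u' v' =
      if [&& k == b + r, u' < t & v' < neval s ev]%N then S r u' v' else flds s0 arr k u' v'].
apply: (@exec_for _ rt I) => [|t st _ [i1 i2 i3]].
  by split=> // k u' v'; rewrite ltn0 !andbF.
have [||j1 j2 j3] := @tset_vloop r t (tick 1 (set_int vu 0 t st)).
  move=> x i; rewrite !inE !xpair_eqE => xi.
  rewrite /=; case E: ((x == vu) && (i == 0%N)) => //.
  have xi' : (x, i) \notin [:: (vu, 0%N); (vv, 0%N); (vz, 0%N)].
    by rewrite !inE !xpair_eqE E.
  by rewrite i1 // hi.
  exact: i2.
split=> //.
- move=> x i xi; rewrite -i1 // j1 /=; first by move: xi; rewrite !inE !xpair_eqE negb_or => /andP[/negbTE ->].
  by move: xi; rewrite !inE !xpair_eqE negb_or => /andP[].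
- move=> k u' v'; rewrite j3 /= i3 [in RHS]ltnS [in RHS]leq_eqVlt.
  case: (k == _) => //=.
  by case: eqP => [->|] //=; rewrite ltnn; case: ifP.
Qed.

Lemma tset_flds k u v :
  flds (exec rt (tset arr eb er eu ev ew body) s) arr k u v =
    if [&& neval s eb <= k < neval s eb + neval s er, u < neval s eu & v < neval s ev]%N
    then \sum_(z < neval s ew) feval (loopst s (k - neval s eb) u v z) body
    else flds s arr k u v.
Proof.
pose I t st := [/\ ieq [:: (vr, 0%N); (vu, 0%N); (vv, 0%N); (vz, 0%N)] s st, foff st &
    forall k u' v', flds st arr k u' v' =
      if [&& b <= k < b + t, u' < neval s eu & v' < neval s ev]%N
      then S (k - b) u' v' else flds s arr k u' v'].
suff [_ _ H] : I (neval s er) (exec rt (tset arr eb er eu ev ew body) s) by apply: H.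
apply: exec_for => [|t st _ [i1 i2 i3]].
  by split=> // k' u' v'; rewrite addn0 leqNgt andNb.
have [||j1 j2 j3] := @tset_uloop t (tick 1 (set_int vr 0 t st)).
  move=> x i; rewrite !inE !xpair_eqE => xi.
  rewrite /=; case E: ((x == vr) && (i == 0%N)) => //.
  have xi' : (x, i) \notin [:: (vr, 0%N); (vu, 0%N); (vv, 0%N); (vz, 0%N)].
    by rewrite !inE !xpair_eqE E.
  by rewrite i1.
  exact: i2.
split=> //.
- move=> x i xi; rewrite -i1 // j1 /=; first by move: xi; rewrite !inE !xpair_eqE negb_or => /andP[/negbTE ->].
  by move: xi; rewrite !inE !xpair_eqE negb_or => /andP[].
- move=> k' u' v'; rewrite j3 /= i3 addnS [in RHS]ltnS.
  case: eqP => [->|/eqP ne] /=.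
    by rewrite leq_addr ltnn leqnn addKn /=; case: ifP.
  by rewrite [(k' <= b + t)%N]leq_eqVlt (negbTE ne).
Qed.

End Tset.

(** * Running time *)

(** Subtraction is truncated, so a difference never exceeds its first operand; [clip] relies on this
    case. *)
Fixpoint small_nexp (e : nexp) : bool :=
  match e with
  | NCst n => (n <= 1)%N
  | NGet _ _ => true
  | NSub a _ => small_nexp a
  | _ => false
  end.

(* Programs in which no integer ever exceeds 1 and the largest one
   present at the start; since loop bounds are then bounded too, they run in polynomial
   time. *)
Fixpoint small_cmd (c : cmd) : bool :=
  match c with
  | CNSet _ _ e | CRoots _ _ _ e => small_nexp e
  | CSeq a b | CIf _ a b => small_cmd a && small_cmd b
  | CFor _ e a => small_nexp e && small_cmd a
  | _ => true
  end.

Section Cost.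
Variable K : fieldType.
Implicit Types (s : state K) (c : cmd) (rt : {poly K} -> seq K).

Definition ints_le (B : nat) s := forall x i, (ints s x i <= B)%N.

(** Costs are bounded by single powers of B: as B is at least 2, the factor 2 lost in a sum is
    absorbed by one more exponent. *)
Lemma expn_bound_add B i j a b : (1 < B)%N ->
  (a <= B ^ i)%N -> (b <= B ^ j)%N -> (a + b <= B ^ (i + j).+1)%N.
Proof.
move=> B2 ha hb; have B0 : (0 < B)%N by apply: ltnW.
apply: (@leq_trans (2 * B ^ (i + j))); last by rewrite expnS leq_mul2r B2 orbT.
rewrite mul2n -addnn leq_add //.
  by apply: leq_trans ha _; rewrite leq_pexp2l ?leq_addr.
by apply: leq_trans hb _; rewrite leq_pexp2l ?leq_addl.
Qed.

Lemma expn_bound_succ B i a : (1 < B)%N -> (a <= B ^ i)%N -> (a.+1 <= B ^ i.+1)%N.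
Proof.
by move=> B2 h; rewrite -addn1 -[X in (_ <= B ^ X.+1)%N]addn0; apply: expn_bound_add.
Qed.

Lemma neval_bound e : exists k, forall B s,
  (1 < B)%N -> ints_le B s -> (neval s e <= B ^ k)%N.
Proof.
elim: e => [n|x e _|a [i IHa] b [j IHb]|a [i IHa] b _|a [i IHa] b [j IHb]].
- by exists n => B s B2 _ /=; rewrite ltnW // ltn_expl.
- by exists 1%N => B s _ H /=; rewrite expn1.
- exists (i + j).+1 => B s B2 H /=.
  by apply: expn_bound_add => //; [apply: IHa|apply: IHb].
- by exists i => B s B2 H /=; apply: leq_trans (leq_subr _ _) (IHa _ _ B2 H).
- by exists (i + j)%N => B s B2 H /=; rewrite expnD leq_mul ?IHa ?IHb.
Qed.

Lemma bitcost_bound n : (bitcost n <= n.+1)%N.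
Proof.
rewrite ltnS; case: n => // n; apply: leq_trans (trunc_logP (isT : 1 < 2)%N (isT : 0 < n.+1)%N).
by rewrite ltnW // ltn_expl.
Qed.

Lemma ncost_bound e : exists k, forall B s,
  (1 < B)%N -> ints_le B s -> (ncost s e <= B ^ k)%N.
Proof.
have op o a b : (forall s, ncost s (o a b) = ncost s a + ncost s b + bitcost (neval s (o a b)))%N ->
  (exists k, forall B s, (1 < B)%N -> ints_le B s -> (ncost s a <= B ^ k)%N) ->
  (exists k, forall B s, (1 < B)%N -> ints_le B s -> (ncost s b <= B ^ k)%N) ->
  exists k, forall B s, (1 < B)%N -> ints_le B s -> (ncost s (o a b) <= B ^ k)%N.
  move=> E [i IHa] [j IHb]; have [l Hl] := neval_bound (o a b).
  exists ((i + j).+1 + l.+1).+1 => B s B2 H; rewrite E.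
  apply: expn_bound_add => //; first by apply: expn_bound_add; rewrite ?IHa ?IHb.
  by apply: leq_trans (bitcost_bound _) _; apply: expn_bound_succ => //; apply: Hl.
elim: e => [n|x e [i IH]|a IHa b IHb|a IHa b IHb|a IHa b IHb]; try by apply: op.
- by exists 0%N.
- by exists i.+1 => B s B2 H /=; apply: expn_bound_succ => //; apply: IH.
Qed.

Lemma fcost_bound e : exists k, forall B s,
  (1 < B)%N -> ints_le B s -> (fcost s e <= B ^ k)%N.
Proof.
elim: e => [n|x a b c|a [i IHa] b [j IHb]|a [i IHa]|a [i IHa] b [j IHb]|a [i IHa]].
- by exists 0%N.
- have [i Hi] := ncost_bound a; have [j Hj] := ncost_bound b.
  have [l Hl] := ncost_bound c; exists ((i + j).+1 + l).+2 => B s B2 H /=.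
  apply: expn_bound_succ => //; apply: expn_bound_add; rewrite ?Hl //.
  by apply: expn_bound_add; rewrite ?Hi ?Hj.
all: try by exists i.+1 => B s B2 H /=; apply: expn_bound_succ => //; apply: IHa.
all: exists (i + j).+2 => B s B2 H /=; apply: expn_bound_succ => //.
all: by apply: expn_bound_add; rewrite ?IHa ?IHb.
Qed.

Lemma bcost_bound e : exists k, forall B s,
  (1 < B)%N -> ints_le B s -> (bcost s e <= B ^ k)%N.
Proof.
elim: e => [a b|a b|a [i IHa]|a [i IHa] b [j IHb]].
- have [i Hi] := ncost_bound a; have [j Hj] := ncost_bound b.
  exists (i + j).+2 => B s B2 H /=; apply: expn_bound_succ => //.
  by apply: expn_bound_add; rewrite ?Hi ?Hj.
- have [i Hi] := fcost_bound a; have [j Hj] := fcost_bound b.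
  exists (i + j).+2 => B s B2 H /=; apply: expn_bound_succ => //.
  by apply: expn_bound_add; rewrite ?Hi ?Hj.
- by exists i.+1 => B s B2 H /=; apply: expn_bound_succ => //; apply: IHa.
- exists (i + j).+2 => B s B2 H /=; apply: expn_bound_succ => //.
  by apply: expn_bound_add; rewrite ?IHa ?IHb.
Qed.

Lemma small_nexpP B s e : (0 < B)%N -> ints_le B s -> small_nexp e -> (neval s e <= B)%N.
Proof.
move=> B1 H; elim: e => //= [n n1|a IHa b _ /IHa h]; first exact: leq_trans n1 B1.
exact: leq_trans (leq_subr _ _) h.
Qed.

Lemma set_int_le B s x i v : (v <= B)%N -> ints_le B s -> ints_le B (set_int x i v s).
Proof. by move=> vB H y j /=; case: ifP. Qed.

(** The number of roots is stored as an integer, so it must respect the bound too; for the zero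
    polynomial the convention of an empty answer is essential. *)
Lemma size_root_finder rt (P : {poly K}) d : root_finder rt -> (size P <= d)%N -> (size (rt P) <= d)%N.
Proof.
move=> rtP Pd; have [u h] := rtP P; have [P0|P0] := eqVneq P 0.
  case E: (rt P) => [//|y r]; have := h y; by rewrite E mem_head P0 eqxx.
apply: leq_trans (ltnW _) Pd; apply: max_poly_roots => //.
by apply/allP => x; rewrite h P0.
Qed.

(** The bound B on the integers is preserved, so each loop makes at most B passes; the exponent
    therefore depends only on the text of [c]. *)
Lemma small_cmd_clock c : small_cmd c -> exists k, forall rt B s,
  root_finder rt -> (1 < B)%N -> ints_le B s ->
  ints_le B (exec rt c s) /\ (clock (exec rt c s) <= clock s + B ^ k)%N.
Proof.
elim: c => [|x i e|x i j k e|x|x g f d|a IHa b IHb|b a1 IH1 a2 IH2|x e a IHa] /=.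
- by exists 0%N.
- move=> he; have [a Ha] := ncost_bound i; have [b Hb] := ncost_bound e.
  exists (a + b).+2 => rt B s rtP B2 H; split.
    by apply: set_int_le => //; apply: small_nexpP => //; apply: ltnW.
  rewrite leq_add2l; apply: expn_bound_succ => //.
  by apply: expn_bound_add; rewrite ?Ha ?Hb.
- move=> _; have [a Ha] := ncost_bound i; have [b Hb] := ncost_bound j.
  have [c Hc] := ncost_bound k; have [d Hd] := fcost_bound e.
  exists (((a + b).+1 + c).+1 + d).+2 => rt B s rtP B2 H; split=> //.
  rewrite leq_add2l; apply: expn_bound_succ => //.
  apply: expn_bound_add; rewrite ?Hd //; apply: expn_bound_add; rewrite ?Hc //.
  by apply: expn_bound_add; rewrite ?Ha ?Hb.
- move=> _; exists 0%N => rt B s rtP B2 H; split=> //.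
  move=> y j /=; case: ifP => // _; case: (head _ _) => //; exact: ltnW.
- move=> hd; have [a Ha] := ncost_bound d.
  exists (a + 1).+2 => rt B s rtP B2 H.
  have hB : (neval s d <= B)%N by apply: small_nexpP => //; apply: ltnW.
  split.
    apply: (@set_int_le B s x 0) => //; apply: leq_trans hB.
    exact: size_root_finder rtP (size_poly _ _).
  rewrite leq_add2l; apply: expn_bound_succ => //.
  by apply: expn_bound_add; rewrite ?Ha ?expn1.
- case/andP=> /IHa[i Hi] /IHb[j Hj]; exists (i + j).+1 => rt B s rtP B2 H.
  rewrite exec_seq; have [h1 h2] := Hi rt _ _ rtP B2 H; have [h3 h4] := Hj rt _ _ rtP B2 h1.
  split=> //; apply: leq_trans h4 _.
  apply: leq_trans (leq_add h2 (leqnn _)) _.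
  by rewrite -addnA leq_add2l; apply: expn_bound_add.
- case/andP=> /IH1[i Hi] /IH2[j Hj]; have [l Hl] := bcost_bound b.
  exists (l.+1 + (i + j).+1).+1 => rt B s rtP B2 H.
  have hb : ((bcost s b).+1 <= B ^ l.+1)%N by apply: expn_bound_succ => //; apply: Hl.
  rewrite /exec -/exec; case: (beval s b).
    have [h1 h2] := Hi rt _ (tick (bcost s b).+1 s) rtP B2 H; split=> //.
    apply: leq_trans h2 _; rewrite -addnA leq_add2l; apply: expn_bound_add => //.
    by rewrite leq_pexp2l ?(ltnW B2) // -addnS leq_addr.
  have [h1 h2] := Hj rt _ (tick (bcost s b).+1 s) rtP B2 H; split=> //.
  apply: leq_trans h2 _; rewrite -addnA leq_add2l; apply: expn_bound_add => //.
  by rewrite leq_pexp2l ?(ltnW B2) // -addSn leq_addl.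
- case/andP=> he /IHa[i Hi]; have [l Hl] := ncost_bound e.
  (* [l.+1] pays for the evaluation of the bound, 1 for the at most B passes, [i.+1] for one pass
     with its tick. *)
  exists (l.+1 + (1 + i.+1)).+1 => rt B s rtP B2 H.
  have hB : (neval s e <= B)%N by apply: small_nexpP => //; apply: ltnW.
  pose I t st := ints_le B st /\ (clock st <= clock s + (ncost s e).+1 + t * B ^ i.+1)%N.
  have : I (neval s e) (exec rt (CFor x e a) s).
    apply: exec_for => [|t st lt [i1 i2]]; first by rewrite /I mul0n addn0.
    have [|h1 h2] := Hi rt B (tick 1 (set_int x 0 t st)) rtP B2.
      apply: (@set_int_le B st x 0 t) => //; exact: ltnW (leq_trans lt hB).
    split=> //; apply: leq_trans h2 _.
    rewrite mulSn [(B ^ _ + _)%N]addnC addnA /= -[(clock st + 1 + _)%N]addnA leq_add // add1n.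
    by apply: expn_bound_succ.
  case=> h1 h2; split=> //; apply: leq_trans h2 _.
  rewrite -addnA leq_add2l; apply: expn_bound_add => //.
    by apply: expn_bound_succ => //; apply: Hl.
  by rewrite expnD expn1 leq_mul.
Qed.

End Cost.

(** * Linear algebra *)

Section SpanElim.
Variables (K : fieldType) (vT : vectType K).
Implicit Types (b : nat -> vT) (R : nat) (X : vT).

Definition span_of (b : nat -> vT) (R : nat) : {vspace vT} :=
  <<[tuple b i | i < R]>>%VS.

Lemma span_ofP b R X :
  reflect (exists c : 'I_R -> K, X = \sum_i c i *: b i) (X \in span_of b R).
Proof.
apply: (iffP idP) => [h|[c ->]].
  exists (fun i => coord [tuple b i | i < R] i X); rewrite {1}(coord_span h).
  by apply: eq_bigr => i _; rewrite (nth_map i) ?size_enum_ord // nth_ord_enum.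
apply: memv_suml => i _; apply/memvZ/memv_span; apply/mapP; exists i => //.
by rewrite mem_enum.
Qed.

Lemma mem_span_of b R i : (i < R)%N -> b i \in span_of b R.
Proof.
move=> h; apply/memv_span/mapP; exists (Ordinal h) => //.
by rewrite mem_enum.
Qed.

Lemma eq_span_of b (b' : nat -> vT) R : (forall i, (i < R)%N -> b' i = b i) -> span_of b' R = span_of b R.
Proof. by move=> h; congr (<<_>>%VS); apply: eq_map => i; apply: h. Qed.

Lemma span_of_sub b R (U : {vspace vT}) :
  (forall i, (i < R)%N -> b i \in U) -> (span_of b R <= U)%VS.
Proof. by move=> h; apply/span_subvP => _ /mapP[i _ ->]; apply: h. Qed.

Variable phi : vT -> K.
Hypothesis phi_lin : forall a x y, phi (a *: x + y) = a * phi x + phi y.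

(** One elimination step for the equation phi = 0. The pivot row itself becomes 0, so the family
    keeps its size while its span loses one dimension. Without a pivot every coefficient is 0 and
    nothing changes. *)
Lemma span_elim b (b' : nat -> vT) q R (found : bool) :
  (forall r, (r < R)%N -> b' r = b r - (phi (b r) * (phi (b q))^-1) *: b q) ->
  (if found then (q < R)%N /\ phi (b q) != 0 else forall r, (r < R)%N -> phi (b r) = 0) ->
  (forall X, X \in span_of b' R <-> X \in span_of b R /\ phi X = 0) /\
  \dim (span_of b R) = (\dim (span_of b' R) + found)%N.
Proof.
have phi0 : phi 0 = 0.
  by move: (phi_lin (-1) 0 0); rewrite scaler0 addr0 mulN1r addNr.
have phiD x y : phi (x + y) = phi x + phi y.
  by have := phi_lin 1 x y; rewrite scale1r mul1r.
have phiZ a x : phi (a *: x) = a * phi x by rewrite -[_ *: _]addr0 phi_lin phi0 addr0.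
have phiS I (r : seq I) (F : I -> vT) : phi (\sum_(i <- r) F i) = \sum_(i <- r) phi (F i).
  exact: (big_morph phi phiD phi0).
move=> hb'; case: found => [[qR nz]|z]; last first.
  have -> : span_of b' R = span_of b R.
    by apply: eq_span_of => i h; rewrite hb' // z // mul0r scale0r subr0.
  split=> [X|]; last by rewrite addn0.
  split=> [h|[]//]; split=> //; have [c ->] := span_ofP _ _ _ h.
  by rewrite phiS big1 // => i _; rewrite phiZ z // mulr0.
have phib' r : (r < R)%N -> phi (b' r) = 0.
  by move=> h; rewrite hb' // -scaleNr addrC phi_lin mulNr divfK // addNr.
have sub' : (span_of b' R <= span_of b R)%VS.
  by apply: span_of_sub => i h; rewrite hb' // rpredB ?rpredZ ?mem_span_of.
have ker' X : X \in span_of b' R -> phi X = 0.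
  by move/span_ofP=> [c ->]; rewrite phiS big1 // => i _; rewrite phiZ phib' // mulr0.
split.
  move=> X; split=> [h|[/span_ofP[c ->]]].
    by split; [apply: (subvP sub')|apply: ker'].
  (* The coefficients on [b] also work on [b']: the corrections add up to phi X / phi (b q) times
     [b q], which is 0. *)
  rewrite phiS => h0; apply/span_ofP; exists c.
  rewrite (eq_bigr (fun i : 'I_R => c i *: b' i + (c i * (phi (b i) * (phi (b q))^-1)) *: b q)).
    rewrite big_split /= -scaler_suml.
    suff -> : \sum_(i < R) c i * (phi (b i) * (phi (b q))^-1) = 0 by rewrite scale0r addr0.
    transitivity ((\sum_(i < R) phi (c i *: b i)) * (phi (b q))^-1); last by rewrite h0 mul0r.
    by rewrite mulr_suml; apply: eq_bigr => i _; rewrite phiZ mulrA.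
  by move=> i _; rewrite hb' // scalerBr scalerA subrK.
have -> : span_of b R = (span_of b' R + <[b q]>)%VS.
  apply/eqP; rewrite eqEsubv subv_add sub' -memvE mem_span_of // !andbT.
  apply: span_of_sub => i h; rewrite -[b i](subrK ((phi (b i) * (phi (b q))^-1) *: b q)).
  by rewrite -hb' // memv_add ?mem_span_of // memvZ // memv_line.
(* The sum is direct because phi vanishes on the span of [b'] but not at [b q]. *)
rewrite dimv_disjoint_sum; last first.
  apply/eqP; rewrite -subv0; apply/subvP => X; rewrite memv_cap => /andP[/ker' h /vlineP[a e]].
  move: h; rewrite e phiZ => /eqP; rewrite mulf_eq0 (negbTE nz) orbF => /eqP ->.
  by rewrite scale0r mem0v.
rewrite dim_vline; case: eqP => //= e; move: nz; by rewrite e phi0 eqxx.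
Qed.

End SpanElim.

(** * Kernels and ranks *)

Section Rank.
Variable K : fieldType.

Lemma dim_kernel_rank n m (U : {vspace 'rV[K]_n}) (C : 'M[K]_(n, m)) :
  (forall X, X \in U <-> X *m C = 0) -> (\dim U + \rank C = n)%N.
Proof.
move=> H; set k := \rank (kermx C); set rb := row_base (kermx C).
pose X := [tuple row i rb | i < k].
have Xi (i : 'I_k) : X`_i = row i rb.
  by rewrite (nth_map i) ?size_enum_ord // nth_ord_enum.
have freeX : free X.
  apply/freeP => c /= h i.
  have : (\row_j c j) *m rb = 0.
    rewrite mulmx_sum_row -[RHS]h; apply: eq_bigr => j _; by rewrite Xi mxE.
  have rf : row_free rb := row_base_free _.
  move/eqP; rewrite mulmx_free_eq0 // => /eqP/rowP/(_ i); by rewrite !mxE.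
have -> : U = <<X>>%VS.
  apply/vspaceP => x; apply/idP/idP => [/H/eqP h|h].
    have /submxP[D ->] : (x <= rb)%MS by rewrite eq_row_base; apply/sub_kermxP/eqP.
    rewrite mulmx_sum_row; apply: memv_suml => i _; apply/memvZ/memv_span.
    by apply/mapP; exists i => //; rewrite mem_enum.
  apply/H; rewrite (coord_span h) mulmx_suml big1 // => i _.
  rewrite -scalemxAl Xi; have -> : row i rb *m C = 0; last by rewrite scaler0.
  by apply/sub_kermxP; rewrite -(eq_row_base (kermx C)) row_sub.
by rewrite (eqP freeX) size_tuple /k mxrank_ker subnK // rank_leq_row.
Qed.

(** The columns of [cokermx A] lie in the kernel of A, and being killed by [cokermx A] characterises
    the row space of A. *)
Lemma kernel_submx m1 m2 n (A : 'M[K]_(m1, n)) (B : 'M[K]_(m2, n)) :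
  (forall u : 'cV_n, A *m u = 0 -> B *m u = 0) <-> (B <= A)%MS.
Proof.
split=> [h|/submxP[D ->] u e]; last by rewrite -mulmxA e mulmx0.
rewrite submxE; apply/eqP/matrixP => i j; rewrite [RHS]mxE.
have e : A *m col j (cokermx A) = 0.
  by rewrite colE mulmxA mulmx_coker mul0mx.
have /colP/(_ i) := h _ e.
by rewrite colE mulmxA -colE [LHS]mxE => ->; rewrite mxE.
Qed.

End Rank.

(** * Maps diagonal in the hidden basis *)

Section Hidden.
Variables (K : fieldType) (m n p : nat) (V : {vspace 'M[K]_(m, n)}).
Variables (M Z : p.-tuple 'M[K]_(m, n)).
Hypothesis basisM : basis_of V M.
Hypothesis dir_col : directv (\sum_(i < p) Im (tnth M i))%VS.
Hypothesis dir_row : directv (\sum_(i < p) Im (tnth M i)^T)%VS.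
Hypothesis basisZ : basis_of V Z.

Lemma mem_Im m1 n1 (A : 'M[K]_(m1, n1)) u : A *m u \in Im A.
Proof. by have := memv_img (linfun (mulmx A)) (memvf u); rewrite lfunE. Qed.

Lemma hidden_neq0 i : tnth M i != 0.
Proof.
apply: contraTneq (basis_free basisM) => e; apply/negP => /free_not0 H.
by have := H _ (mem_tnth i M); rewrite e eqxx.
Qed.

Lemma col_direct (u : 'I_p -> 'cV[K]_n) :
  \sum_i tnth M i *m u i = 0 -> forall i, tnth M i *m u i = 0.
Proof.
move=> h i; move/directv_sum_independent: dir_col => /(_ (fun i => tnth M i *m u i)) H.
by apply: H => // j _; apply: mem_Im.
Qed.

(** If M_j = D M_i, the image of M_j^T lies in that of M_i^T; independent spaces meet only in 0, so
    M_j would vanish. *)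
Lemma row_direct i j : i != j -> ~~ (tnth M j <= tnth M i)%MS.
Proof.
move=> ij; apply/negP => /submxP[D e].
suff /eqP : (tnth M j)^T = 0 by rewrite trmx_eq0 (negbTE (hidden_neq0 j)).
have H (u : 'cV_m) : (tnth M j)^T *m u = 0.
  move/directv_sum_independent: dir_row.
  (* The same vector, with opposite signs, is placed in the summands i and j: the family sums to 0,
     so its members vanish. *)
  move=> /(_ (fun k => if k == i then - ((tnth M j)^T *m u) else
                       if k == j then (tnth M j)^T *m u else 0)) H.
  have := H _ _ j isT; rewrite eq_sym (negbTE ij) eqxx; apply.
    move=> k _; case: eqP => [->|_]; last by case: eqP => [->|_]; rewrite ?mem0v ?mem_Im.
    by rewrite rpredN e trmx_mul -mulmxA mem_Im.
  rewrite (bigD1 i) //= eqxx (bigD1 j) /=; last by rewrite eq_sym.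
  rewrite eq_sym (negbTE ij) eqxx big1 ?addr0 ?addNr // => k /andP[/negbTE-> /negbTE->] //.
apply/matrixP => a b; have /colP/(_ a) := H (delta_mx b 0).
by rewrite -colE [LHS]mxE => ->; rewrite !mxE.
Qed.

(** If u is killed by the combination, [col_direct] splits the sum and gives a_i M_i u = 0;
    inclusion of kernels is then inclusion of row spaces. *)
Lemma hidden_comb_sub (a : 'I_p -> K) i :
  a i != 0 -> (tnth M i <= (\sum_k a k *: tnth M k)%R)%MS.
Proof.
move=> ai; apply/kernel_submx => u; rewrite mulmx_suml => h.
have h' : \sum_k tnth M k *m (a k *: u) = 0.
  by rewrite -[RHS]h; apply: eq_bigr => k _; rewrite -scalemxAr scalemxAl.
have /eqP := col_direct h' i.
by rewrite -scalemxAr scaler_eq0 (negbTE ai) => /eqP.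
Qed.

Lemma hidden_comb_rank (a : 'I_p -> K) i :
  a i != 0 -> (\rank (tnth M i) <= \rank (\sum_k a k *: tnth M k)%R)%N.
Proof. by move=> ai; apply/mxrankS/hidden_comb_sub. Qed.

(** Equal ranks would make the row space of the combination that of M_i; but it also contains that
    of M_j, against [row_direct]. *)
Lemma hidden_comb_rank_lt (a : 'I_p -> K) i j :
  i != j -> a i != 0 -> a j != 0 -> (\rank (tnth M i) < \rank (\sum_k a k *: tnth M k)%R)%N.
Proof.
move=> ij ai aj; rewrite ltn_neqAle hidden_comb_rank // andbT.
rewrite (mxrank_leqif_sup (hidden_comb_sub ai)); apply: contra (row_direct ij).
exact/submx_trans/hidden_comb_sub.
Qed.

Definition transition : 'M[K]_p := \matrix_(k, i) coord M i (tnth Z k).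
Local Notation t := transition.

Lemma transitionE k : tnth Z k = \sum_i t k i *: tnth M i.
Proof.
have h : tnth Z k \in <<M>>%VS by rewrite (span_basis basisM); apply: (basis_mem basisZ); apply: mem_tnth.
rewrite {1}(coord_span h); apply: eq_bigr => i _; by rewrite mxE -tnth_nth.
Qed.

Lemma transition_unit : t \in unitmx.
Proof.
pose t' : 'M[K]_p := \matrix_(i, k) coord Z k (tnth M i).
have e i : tnth M i = \sum_k t' i k *: tnth Z k.
  have h : tnth M i \in <<Z>>%VS by rewrite (span_basis basisZ); apply: (basis_mem basisM); apply: mem_tnth.
  rewrite {1}(coord_span h); apply: eq_bigr => k _; by rewrite mxE -tnth_nth.
suff /mulmx1_unit[] : t' *m t = 1%:M by [].
apply/matrixP => i j; have /freeP H := basis_free basisM.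
have := H (fun l => (t' *m t) i l - (1%:M : 'M_p) i l) _ j => /(_ _)/eqP.
rewrite subr_eq0 => h; apply/eqP/h.
rewrite (eq_bigr (fun l => (t' *m t) i l *: tnth M l - (1%:M : 'M_p) i l *: tnth M l)); last first.
  by move=> l _; rewrite scalerBl -!tnth_nth.
have e1 : \sum_l (1%:M : 'M[K]_p) i l *: tnth M l = tnth M i.
  rewrite (bigD1 i) //= mxE eqxx scale1r big1 ?addr0 // => l.
  by rewrite mxE eq_sym => /negbTE ->; rewrite scale0r.
rewrite sumrB e1 [tnth M i]e; apply/eqP; rewrite subr_eq0; apply/eqP.
under eq_bigr => l _ do rewrite mxE scaler_suml.
rewrite exchange_big; apply: eq_bigr => k _; rewrite transitionE scaler_sumr.
by apply: eq_bigr => l _; rewrite scalerA.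
Qed.

(** The matrix, in the input basis [Z], of the map that multiplies each M_i by w_i. *)
Definition hdiag (w : 'rV[K]_p) : 'M[K]_p := t *m diag_mx w *m invmx t.

Lemma hdiagE w k l : hdiag w k l = \sum_i t k i * w 0 i * invmx t i l.
Proof.
rewrite mxE; apply: eq_bigr => i _; rewrite mul_mx_diag mxE; congr (_ * _).
Qed.

Lemma hdiag_mul w w' : hdiag w *m hdiag w' = hdiag (\row_i (w 0 i * w' 0 i)).
Proof.
rewrite /hdiag !mulmxA mulmxKV ?transition_unit // -[t *m _ *m _]mulmxA mulmx_diag.
by [].
Qed.

Lemma hdiag_lin a w w' : hdiag (a *: w + w') = a *: hdiag w + hdiag w'.
Proof. by rewrite /hdiag !linearP /= mulmxDl -scalemxAl. Qed.

Lemma hdiag1 : hdiag (const_mx 1) = 1%:M.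
Proof. by rewrite /hdiag diag_const_mx mulmx1 mulmxV ?transition_unit. Qed.

Lemma hdiag0 : hdiag 0 = 0.
Proof. by rewrite /hdiag linear0 mulmx0 mul0mx. Qed.

Lemma hdiag_eq0 w : hdiag w = 0 -> w = 0.
Proof.
move=> h; have : invmx t *m hdiag w *m t = diag_mx w.
  by rewrite /hdiag -mulmxA mulmxKV ?transition_unit // mulKmx ?transition_unit.
rewrite h mulmx0 mul0mx => e; apply/rowP => i; rewrite mxE.
by have /matrixP/(_ i i) := e; rewrite !mxE eqxx mulr1n => <-.
Qed.

Lemma hdiag_tr w : \tr (hdiag w) = \sum_i w 0 i.
Proof. by rewrite /hdiag mxtrace_mulC mulmxA mulVmx ?transition_unit // mul1mx mxtrace_diag. Qed.

Lemma hdiag_row w k : \sum_l hdiag w k l *: tnth Z l = \sum_i (t k i * w 0 i) *: tnth M i.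
Proof.
under eq_bigr => l _ do rewrite transitionE scaler_sumr.
rewrite exchange_big; apply: eq_bigr => i _ /=.
under eq_bigr => l _ do rewrite scalerA.
rewrite -scaler_suml; congr (_ *: _).
have /matrixP/(_ k i) : hdiag w *m t = t *m diag_mx w.
  by rewrite /hdiag mulmxKV ?transition_unit.
by rewrite mul_mx_diag !mxE.
Qed.

(** The vectors x_k are stored as the rows of one matrix, so that a change of basis acts on [x] by
    left multiplication. *)
Definition relation_of (B : p.-tuple 'M[K]_(m, n)) (x : 'M[K]_(p, n)) : Prop :=
  \sum_k tnth B k *m (row k x)^T = 0.

Lemma relationZ x : relation_of Z x <-> forall i, tnth M i *m (row i (t^T *m x))^T = 0.
Proof.
have e : \sum_k tnth Z k *m (row k x)^T = \sum_i tnth M i *m (row i (t^T *m x))^T.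
  under eq_bigr => k _ do rewrite transitionE mulmx_suml.
  rewrite exchange_big; apply: eq_bigr => i _ /=.
  rewrite row_mul mulmx_sum_row linear_sum mulmx_sumr; apply: eq_bigr => k _.
  by rewrite linearZ /= -scalemxAr -scalemxAl !mxE.
rewrite /relation_of e; split=> [/col_direct//|h]; by apply: big1.
Qed.

(** Substituting sum_l c_kl Z_l for Z_k amounts to replacing x by c^T x. In hidden coordinates c
    becomes s = t^-1 c t; relations with a single nonzero row force s to be diagonal, and a diagonal
    s only rescales the terms M_i y_i. *)
Lemma preserves_relationsP c :
  (forall x, relation_of Z x -> relation_of Z (c^T *m x)) <-> exists w, c = hdiag w.
Proof.
have tU := transition_unit; have tTU : t^T \in unitmx by rewrite unitmx_tr.
split=> [H|[w ->] x /relationZ h]; last first.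
  apply/relationZ => i; rewrite /hdiag !trmx_mul tr_diag_mx !mulmxA -trmx_mul mulVmx //.
  rewrite trmx1 mul1mx -mulmxA row_mul.
  have -> : row i (diag_mx w) = w 0 i *: delta_mx 0 i.
    apply/rowP => j; rewrite !mxE eqxx /= eq_sym; by case: eqP => _; rewrite ?mulr1 ?mulr0 ?mulr1n ?mulr0n.
  by rewrite -scalemxAl -rowE linearZ /= -scalemxAr h scaler0.
pose s := invmx t *m c *m t.
have offdiag h i : h != i -> s h i = 0.
  move=> hi; apply/eqP; apply: contraNT (row_direct hi) => sn; apply/kernel_submx => u hu.
  (* In hidden coordinates: u at place h and 0 elsewhere, a relation since M_h u = 0. Its transform
     has s_hi u at place i. *)
  pose xi : 'M[K]_(p, n) := delta_mx h 0 *m u^T.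
  have rel : relation_of Z (invmx t^T *m xi).
    apply/relationZ => k; rewrite mulKVmx // /xi row_mul.
    have [->|kh] := eqVneq k h.
      have -> : row h (delta_mx h 0 : 'M[K]_(p, 1)) = 1%:M.
        by apply/rowP => j; rewrite !mxE !ord1 eqxx.
      by rewrite mul1mx trmxK.
    have -> : row k (delta_mx h 0 : 'M[K]_(p, 1)) = 0.
      by apply/rowP => j; rewrite !mxE (negbTE kh).
    by rewrite mul0mx trmx0 mulmx0.
  have /relationZ/(_ i) := H _ rel.
  have -> : t^T *m (c^T *m (invmx t^T *m xi)) = s^T *m xi.
    by rewrite /s !trmx_mul trmx_inv !mulmxA.
  have -> : row i (s^T *m xi) = s h i *: u^T.
    rewrite row_mul /xi mulmxA -[RHS]mul_scalar_mx; congr (_ *m _).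
    by apply/rowP => j; rewrite !ord1 -colE !mxE eqxx mulr1n.
  rewrite linearZ /= trmxK -scalemxAr => /eqP.
  by rewrite scaler_eq0 (negbTE sn) => /eqP.
exists (\row_i s i i).
have -> : c = t *m s *m invmx t.
  by rewrite /s !mulmxA mulmxV // mul1mx mulmxK.
clearbody s; congr (_ *m _ *m _); apply/matrixP => h i; rewrite !mxE.
have [->|hi] := eqVneq h i; first by rewrite mulr1n.
by rewrite mulr0n offdiag.
Qed.

End Hidden.

(** * Solving linear systems *)

Notation vBIG := 20%N (only parsing).
Notation vDU := 21%N (only parsing).
Notation vDV := 22%N (only parsing).
Notation vR := 23%N (only parsing).
Notation vFOUND := 24%N (only parsing).
Notation vPIV := 25%N (only parsing).
Notation vCNT := 26%N (only parsing).
Notation vL := 27%N (only parsing).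
Notation aONE := 11%N (only parsing).
Notation aB := 12%N (only parsing).
Notation aB2 := 13%N (only parsing).
Notation aF := 14%N (only parsing).
Notation aT := 15%N (only parsing).
Notation aY := 16%N (only parsing).

Definition setv (x : nat) (e : nexp) : cmd := CNSet x (NCst 0) e.
(** By truncation this is the minimum of [e] and [vBIG], in a form that [small_nexp] accepts
    whatever [e] is. *)
Definition clip (e : nexp) : nexp := NSub (nvar vBIG) (NSub (nvar vBIG) e).
(* The cell [0, a - b, b - a] of the array aONE is 1 if a = b and 0 otherwise,
   as its only nonzero cell is [0, 0, 0] and subtraction is truncated. *)
Definition kron (a b : nexp) : fexp := FGet aONE (NCst 0) (NSub a b) (NSub b a).
Definition fget2 (x : nat) (u v : nexp) : fexp := FGet x (NCst 0) u v.
Definition seqc (cs : seq cmd) : cmd :=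
  if cs is c :: cs' then foldl CSeq c cs' else CSkip.

(* The rows aB[r] always span the space of the du x dv arrays that satisfy the
   equations processed so far; vCNT counts the independent ones. *)
Definition solve_init (du dv : nexp) : cmd := seqc
  [:: setv vDU (clip du); setv vDV (clip dv);
      setv vR (clip (NMul (nvar vDU) (nvar vDV))); setv vCNT (NCst 0);
      tset aB (NCst 0) (nvar vR) (nvar vDU) (nvar vDV) (NCst 1)
        (kron (nvar vr) (NAdd (NMul (nvar vu) (nvar vDV)) (nvar vv)))].

(** Any row with a nonzero value in [aY] can serve; the last one is kept. *)
Definition find_pivot : cmd := seqc
  [:: setv vFOUND (NCst 0); setv vPIV (NCst 0);
      CFor vL (nvar vR)
        (CIf (BFEq (fget2 aY (nvar vL) (NCst 0)) (FCst 0)) CSkip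
           (seqc [:: setv vFOUND (NCst 1); setv vPIV (nvar vL)]))].

(** The detour through [aB2] is needed because every new row uses the old pivot row, which is itself
    overwritten. *)
Definition eliminate : cmd := seqc
  [:: tset aB2 (NCst 0) (nvar vR) (nvar vDU) (nvar vDV) (NCst 1)
        (FAdd (FGet aB (nvar vr) (nvar vu) (nvar vv))
          (FOpp (FMul (FMul (fget2 aY (nvar vr) (NCst 0))
                            (FInv (fget2 aY (nvar vPIV) (NCst 0))))
                      (FGet aB (nvar vPIV) (nvar vu) (nvar vv)))));
      tset aB (NCst 0) (nvar vR) (nvar vDU) (nvar vDV) (NCst 1)
        (FGet aB2 (nvar vr) (nvar vu) (nvar vv))].

(** [aF] holds the coefficients of the equation. Its values on the rows of [aB] are double sums,
    hence two passes, [aT] and then [aY]. *)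
Definition solve_step : cmd := seqc
  [:: tset aT (NCst 0) (NCst 1) (nvar vR) (nvar vDU) (nvar vDV)
        (FMul (FGet aB (nvar vu) (nvar vv) (nvar vz)) (fget2 aF (nvar vv) (nvar vz)));
      tset aY (NCst 0) (NCst 1) (nvar vR) (NCst 1) (nvar vDU)
        (fget2 aT (nvar vu) (nvar vz));
      find_pivot; eliminate; setv vCNT (clip (NAdd (nvar vCNT) (nvar vFOUND)))].

Section Solver.
Variables (K : fieldType) (rt : {poly K} -> seq K).
Implicit Types s : state K.

Lemma exec_seqc c cs s :
  exec rt (seqc (c :: cs)) s = foldl (fun s c => exec rt c s) s (c :: cs).
Proof. by rewrite /seqc; elim: cs c s => //= a cs IH c s; rewrite IH. Qed.

Definition one_ok s := forall a b,
  flds s aONE 0 a b = ((a == 0%N) && (b == 0%N))%:R.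

Lemma clipE s e : (neval s e <= ints s vBIG 0)%N -> neval s (clip e) = neval s e.
Proof. by move=> h /=; rewrite subKn. Qed.

Lemma setv_ints x e s y j : ints (exec rt (setv x e) s) y j =
  if (y == x) && (j == 0%N) then neval s e else ints s y j.
Proof. by []. Qed.

Definition pairing (du dv : nat) (X f : 'M[K]_(du, dv)) : K :=
  \sum_u \sum_v X u v * f u v.

Lemma pairing_lin du dv (f : 'M[K]_(du, dv)) a x y :
  pairing (a *: x + y) f = a * pairing x f + pairing y f.
Proof.
rewrite /pairing mulr_sumr -big_split; apply: eq_bigr => u _ /=.
rewrite mulr_sumr -big_split; apply: eq_bigr => v _ /=.
by rewrite !mxE mulrDl mulrA.
Qed.

(** [Q] describes the solution space. The last clause makes [vCNT] its codimension, which is later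
    read off as a rank. *)
Definition solved (du dv : nat) (Q : 'M[K]_(du, dv) -> Prop) s : Prop :=
  [/\ [/\ ints s vDU 0 = du, ints s vDV 0 = dv, ints s vR 0 = (du * dv)%N &
          (du * dv <= ints s vBIG 0)%N],
      forall X, X \in span_of (read_mx du dv s aB) (du * dv) <-> Q X &
      (\dim (span_of (read_mx du dv s aB) (du * dv)) + ints s vCNT 0 = du * dv)%N].

(** [ev] is evaluated after [vDU] has been set, hence the quantification over the value written
    there. *)
Lemma solve_initP du dv eu ev s : one_ok s ->
  neval s eu = du -> (forall v, neval (set_int vDU 0 v s) ev = dv) ->
  (du <= ints s vBIG 0)%N -> (dv <= ints s vBIG 0)%N -> (du * dv <= ints s vBIG 0)%N ->
  solved (fun _ : 'M_(du, dv) => True) (exec rt (solve_init eu ev) s).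
Proof.
move=> one Eu Ev lu lv lr; rewrite /solve_init exec_seqc /foldl.
move E1: (exec rt _ s) => s1; move E2: (exec rt _ s1) => s2.
move E3: (exec rt _ s2) => s3; move E4: (exec rt _ s3) => s4.
move E5: (exec rt _ s4) => s5.
have b1 : ints s1 vBIG 0 = ints s vBIG 0 by rewrite -E1 exec_ints.
have b2 : ints s2 vBIG 0 = ints s vBIG 0 by rewrite -E2 exec_ints.
have e1 : ints s1 vDU 0 = du.
  by rewrite -E1 setv_ints -[LHS]/(neval s (clip eu)) clipE Eu.
have e2 : ints s2 vDV 0 = dv.
  have h : neval s1 ev = dv.
    by rewrite -(Ev (neval s (clip eu))) -E1; apply: neval_ext => x i _; rewrite setv_ints.
  by rewrite -E2 setv_ints -[LHS]/(neval s1 (clip ev)) clipE h // b1.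
have hR : ints s4 vR 0 = (du * dv)%N.
  have h : neval s2 (NMul (nvar vDU) (nvar vDV)) = (du * dv)%N.
    by rewrite /= e2 -E2 exec_ints // e1.
  by rewrite -E4 exec_ints // -E3 setv_ints
       -[LHS]/(neval s2 (clip (NMul (nvar vDU) (nvar vDV)))) clipE h // b2.
have hu : ints s4 vDU 0 = du by rewrite -E4 exec_ints // -E3 exec_ints // -E2 exec_ints.
have hv : ints s4 vDV 0 = dv by rewrite -E4 exec_ints // -E3 exec_ints.
have hB : ints s4 vBIG 0 = ints s vBIG 0 by rewrite -E4 exec_ints // -E3 exec_ints.
have hc : ints s4 vCNT 0 = 0%N by rewrite -E4.
have one4 : one_ok s4.
  by move=> a b; rewrite -E4 exec_flds // -E3 exec_flds // -E2 exec_flds // -E1 exec_flds.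
have B r u v : (r < du * dv)%N -> (u < du)%N -> (v < dv)%N ->
    flds s5 aB r u v = (r == u * dv + v)%N%:R.
  move=> lr' lu' lv'; rewrite -E5 tset_flds //= hR hu hv lr' lu' lv' /= big_ord1.
  by rewrite subn0 one4 !subn_eq0 -eqn_leq.
have full X : X \in span_of (read_mx du dv s5 aB) (du * dv).
  rewrite [X]matrix_sum_delta; apply: memv_suml => u _; apply: memv_suml => v _.
  apply: memvZ; have lt : (u * dv + v < du * dv)%N.
    apply: (@leq_trans (u.+1 * dv)); last by rewrite leq_mul2r ltn_ord orbT.
    by rewrite mulSn addnC ltn_add2r.
  suff -> : delta_mx u v = read_mx du dv s5 aB (u * dv + v) by apply: mem_span_of.
  apply/matrixP => i j; rewrite !mxE B //; congr (_%:R); congr (nat_of_bool _).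
  apply/andP/eqP => [[/eqP-> /eqP->]//|h].
  (* Quotient and remainder by [dv] recover (u, v) from its code u dv + v. *)
  have dv0 : (0 < dv)%N := leq_ltn_trans (leq0n v) (ltn_ord v).
  have /eqP := congr1 (divn^~ dv) h; rewrite !divnMDl // !divn_small // !addn0 => hu'.
  have /eqP := congr1 (modn^~ dv) h; rewrite !modnMDl !modn_small // => hv'.
  by rewrite -!val_eqE /= eq_sym hu' eq_sym hv'.
split=> //; first by rewrite -E5 !exec_ints // hB.
have -> : span_of (read_mx du dv s5 aB) (du * dv) = fullv.
  by apply/vspaceP => X; rewrite full memvf.
by rewrite -E5 exec_ints // hc dimvf /dim /= addn0.
Qed.

Lemma find_pivotP R s : ints s vR 0 = R ->
  let s' := exec rt find_pivot s in
  exists2 found : bool, ints s' vFOUND 0 = found &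
    if found then (ints s' vPIV 0 < R)%N /\ flds s aY 0 (ints s' vPIV 0) 0 != 0
    else forall r, (r < R)%N -> flds s aY 0 r 0 = 0.
Proof.
move=> hR; rewrite /find_pivot exec_seqc /foldl.
move E1: (exec rt (setv vPIV _) _) => s1.
pose I t st := [/\ flds st = flds s &
  exists2 found : bool, ints st vFOUND 0 = found &
    if found then (ints st vPIV 0 < R)%N /\ flds s aY 0 (ints st vPIV 0) 0 != 0
    else forall r, (r < t)%N -> flds s aY 0 r 0 = 0].
suff : I R (exec rt (CFor vL (nvar vR)
        (CIf (BFEq (fget2 aY (nvar vL) (NCst 0)) (FCst 0)) CSkip
           (seqc [:: setv vFOUND (NCst 1); setv vPIV (nvar vL)]))) s1).
  by case=> _ h; exact: h.
have {1}<- : neval s1 (nvar vR) = R by rewrite -hR -E1.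
apply: exec_for => [|t st lt [h1 [f h2 h3]]]; first by split; [rewrite -E1|exists false => //; rewrite -E1].
rewrite /exec -/exec /= h1.
have ltR : (t < R)%N by rewrite -hR; move: lt; rewrite -E1.
have [z|nz] := eqVneq (flds s aY 0 t 0) 0; split=> //=.
  exists f => //; case: f h2 h3 => // _ h3 r; rewrite ltnS leq_eqVlt => /orP[/eqP->//|].
  exact: h3.
by exists true.
Qed.

Lemma solve_stepP du dv (Q : 'M[K]_(du, dv) -> Prop) s : solved Q s ->
  solved (fun X => Q X /\ pairing X (read_mx du dv s aF 0) = 0) (exec rt solve_step s).
Proof.
case=> [[hu hv hR hB] HQ Hdim]; rewrite /solve_step exec_seqc /foldl.
move E1: (exec rt _ s) => s1; move E2: (exec rt _ s1) => s2.
move E3: (exec rt _ s2) => s3; move E4: (exec rt _ s3) => s4.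
move E5: (exec rt _ s4) => s5.
set f := read_mx du dv s aF 0; set b := read_mx du dv s aB.
have T r u : (r < du * dv)%N -> (u < du)%N ->
    flds s1 aT 0 r u = \sum_(v < dv) flds s aB r u v * flds s aF 0 u v.
  by move=> lr lu; rewrite -E1 tset_flds //= hR hu hv lr lu.
have hR1 : ints s1 vR 0 = (du * dv)%N by rewrite -E1 exec_ints.
have hu1 : ints s1 vDU 0 = du by rewrite -E1 exec_ints.
have hv1 : ints s1 vDV 0 = dv by rewrite -E1 exec_ints.
have hR2 : ints s2 vR 0 = (du * dv)%N by rewrite -E2 exec_ints.
have Y r : (r < du * dv)%N -> flds s2 aY 0 r 0 = pairing (b r) f.
  move=> lr; rewrite -E2 tset_flds //= hR1 hu1 lr /=.
  apply: eq_bigr => u _; rewrite /loopst /= T //.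
  by apply: eq_bigr => v _; rewrite !mxE.
have := @find_pivotP (du * dv) s2 hR2; rewrite E3 /=; case=> found hf.
set q := ints s3 vPIV 0 => hq.
have hR3 : ints s3 vR 0 = (du * dv)%N by rewrite -E3 exec_ints.
have hu3 : ints s3 vDU 0 = du by rewrite -E3 exec_ints // -E2 exec_ints.
have hv3 : ints s3 vDV 0 = dv by rewrite -E3 exec_ints // -E2 exec_ints.
have b3 r u v : flds s3 aB r u v = flds s aB r u v.
  by rewrite -E3 exec_flds // -E2 exec_flds // -E1 exec_flds.
have y3 r u v : flds s3 aY r u v = flds s2 aY r u v by rewrite -E3 exec_flds.
have b4 r : (r < du * dv)%N ->
    read_mx du dv s4 aB r = b r - (flds s2 aY 0 r 0 * (flds s2 aY 0 q 0)^-1) *: b q.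
  move=> lr; apply/matrixP => u v; rewrite !mxE -E4 /eliminate exec_seqc /foldl.
  move E6: (exec rt _ s3) => s6; rewrite tset_flds //.
  have hR6 : ints s6 vR 0 = (du * dv)%N by rewrite -E6 exec_ints.
  have hu6 : ints s6 vDU 0 = du by rewrite -E6 exec_ints.
  have hv6 : ints s6 vDV 0 = dv by rewrite -E6 exec_ints.
  rewrite /= hR6 hu6 hv6 lr !ltn_ord /= big_ord1 /loopst /= subn0.
  by rewrite -E6 tset_flds //= hR3 hu3 hv3 lr !ltn_ord /= big_ord1 /loopst /= subn0 !b3 !y3.
have hcnt4 : ints s4 vCNT 0 = ints s vCNT 0.
  by rewrite -E4 exec_ints // -E3 exec_ints // -E2 exec_ints // -E1 exec_ints.
have hbig4 : ints s4 vBIG 0 = ints s vBIG 0.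
  by rewrite -E4 exec_ints // -E3 exec_ints // -E2 exec_ints // -E1 exec_ints.
have hf4 : ints s4 vFOUND 0 = found by rewrite -E4 exec_ints.
have hR4 : ints s4 vR 0 = (du * dv)%N by rewrite -E4 exec_ints.
have hu4 : ints s4 vDU 0 = du by rewrite -E4 exec_ints.
have hv4 : ints s4 vDV 0 = dv by rewrite -E4 exec_ints.
have [] := @span_elim _ _ _ (@pairing_lin _ _ f) b (read_mx du dv s4 aB) q (du * dv) found.
- move=> r lr; rewrite b4 // Y //.
  (* [Y] covers only rows in range. If [q] is out of range, no pivot was found and the factor coming
     from row r is 0. *)
  have [lq|lq] := ltnP q (du * dv); first by rewrite Y.
  case: found hq {hf hf4} => [[]|z]; first by rewrite ltnNge lq.
  have yr : pairing (b r) f = 0 by rewrite -Y // z.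
  by rewrite yr !mul0r !scale0r.
- case: found hq {hf hf4} => [[lq]|z]; first by rewrite -Y.
  by move=> r lr; rewrite -Y // z.
move=> S1 S2.
have eqB : span_of (read_mx du dv s5 aB) (du * dv) = span_of (read_mx du dv s4 aB) (du * dv).
  by apply: eq_span_of => r _; apply/matrixP => u v; rewrite !mxE -E5 exec_flds.
have E : ints s5 vCNT 0 = (ints s vCNT 0 + found)%N.
  rewrite -E5 setv_ints -[LHS]/(neval s4 (clip (NAdd (nvar vCNT) (nvar vFOUND)))).
  have e : neval s4 (NAdd (nvar vCNT) (nvar vFOUND)) = (ints s vCNT 0 + found)%N.
    by rewrite /= hcnt4 hf4.
  (* The dimension count bounds the new counter by [du * dv], so nothing is truncated. *)
  rewrite clipE e // hbig4; apply: leq_trans hB.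
  by rewrite -[leqRHS]Hdim S2 addnC leq_add2r leq_addl.
split; rewrite ?eqB.
- by rewrite -E5 !exec_ints // hbig4.
- move=> X; split=> [/S1[/HQ]//|[/HQ h1 h2]]; exact/S1.
- rewrite E -[RHS]Hdim S2 addnA; exact: addnAC.
Qed.

Lemma solved_iff du dv (Q Q' : 'M[K]_(du, dv) -> Prop) s :
  (forall X, Q X <-> Q' X) -> solved Q s -> solved Q' s.
Proof.
by move=> h [h1 h2 h3]; split=> // X; split=> [/h2/h|/h/h2].
Qed.

Lemma solved_exec du dv (Q : 'M[K]_(du, dv) -> Prop) c s : solved Q s ->
  all (fun x => x \notin iwrites c) [:: vDU; vDV; vR; vBIG; vCNT]%N ->
  aB \notin fwrites c -> solved Q (exec rt c s).
Proof.
move=> [[h1 h2 h3 h4] hQ hd] /and5P[i1 i2 i3 i4 /andP[i5 _]] fB.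
have -> : solved Q (exec rt c s) = solved Q s; last by [].
rewrite /solved !exec_ints //.
suff -> : span_of (read_mx du dv (exec rt c s) aB) (du * dv) = span_of (read_mx du dv s aB) (du * dv) by [].
by apply: eq_span_of => r _; apply/matrixP => u v; rewrite !mxE exec_flds.
Qed.

(** The pattern of every later system: [c] writes one equation into [aF], then [solve_step] imposes
    it. *)
Lemma solve_eqnP du dv (Q : 'M[K]_(du, dv) -> Prop) (eqn : 'M[K]_(du, dv) -> K) c s :
  solved Q s ->
  all (fun x => x \notin iwrites c) [:: vDU; vDV; vR; vBIG; vCNT]%N ->
  aB \notin fwrites c ->
  (forall X, pairing X (read_mx du dv (exec rt c s) aF 0) = eqn X) ->
  solved (fun X => Q X /\ eqn X = 0) (exec rt (seqc [:: c; solve_step]) s).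
Proof.
move=> hs hi hf hE; rewrite exec_seqc /foldl.
by apply: solved_iff (solve_stepP (solved_exec hs hi hf)) => X; rewrite hE.
Qed.

End Solver.

(** * The algebra of diagonal maps *)

Notation nM := (NGet 0 (NCst 0)) (only parsing).
Notation nN := (NGet 0 (NCst 1)) (only parsing).
Notation nP := (NGet 0 (NCst 2)) (only parsing).
Notation vI := 30%N (only parsing).
Notation vX := 31%N (only parsing).
Notation vNX := 44%N (only parsing).
Notation vNG := 45%N (only parsing).
Notation aZ := 0%N (only parsing).
Notation aX := 17%N (only parsing).
Notation aG := 18%N (only parsing).

(** One equation for each of the m coordinates of sum_k Z_k x_k. The solutions are saved in [aX] and
    [vNX], as the next system reuses [aB] and [vR]. *)
Definition relations : cmd := seqc
  [:: solve_init nP nN;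
      CFor vI nM (seqc
        [:: tset aF (NCst 0) (NCst 1) nP nN (NCst 1) (FGet aZ (nvar vu) (nvar vI) (nvar vv));
            solve_step]);
      tset aX (NCst 0) (nvar vR) nP nN (NCst 1) (FGet aB (nvar vr) (nvar vu) (nvar vv));
      setv vNX (nvar vR)].

(** By linearity it suffices to test c on the generators x of the relations: coordinate i of the
    transformed relation is the sum over u, v of c_uv times sum_z Z_v[i, z] x[u, z]. *)
Definition algebra : cmd := seqc
  [:: solve_init nP nP;
      CFor vX (nvar vNX) (CFor vI nM (seqc
        [:: tset aF (NCst 0) (NCst 1) nP nP nN
              (FMul (FGet aZ (nvar vv) (nvar vI) (nvar vz)) (FGet aX (nvar vX) (nvar vu) (nvar vz)));
            solve_step]));
      tset aG (NCst 0) (nvar vR) nP nP (NCst 1) (FGet aB (nvar vr) (nvar vu) (nvar vv));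
      setv vNG (nvar vR)].

Section Algebra.
Variables (K : fieldType) (rt : {poly K} -> seq K).
Variables (m n p : nat) (Z : p.-tuple 'M[K]_(m, n)).
Implicit Types s : state K.

(** Dominates the numbers of unknowns p n, p^2, p + 1 and n of the systems to be solved, and the
    dimensions themselves. *)
Definition big_int := ((m + n + p).+1 ^ 2)%N.

Lemma big_int_le : [/\ (m <= big_int)%N, (n <= big_int)%N, (p.+1 <= big_int)%N,
  (p * n <= big_int)%N & (p * p <= big_int)%N].
Proof.
have le x : (x <= (m + n + p).+1)%N -> (x <= big_int)%N.
  by move=> h; apply: leq_trans h _; rewrite -[X in (X <= _)%N]expn1 leq_pexp2l.
have [a b] : (p <= (m + n + p).+1)%N /\ (n <= (m + n + p).+1)%N.
  by split; rewrite ltnW // ltnS ?leq_addl // -addnA (leq_trans (leq_addr p n)) ?leq_addl.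
split; try (by rewrite /big_int expnS expn1 leq_mul); apply: le => //.
  by rewrite ltnW // ltnS -addnA leq_addr.
by rewrite ltnS leq_addl.
Qed.

Definition ctx s : Prop :=
  [/\ [/\ ints s 0 0 = m, ints s 0 1 = n & ints s 0 2 = p], ints s vBIG 0 = big_int,
      forall k : 'I_p, read_mx m n s aZ k = tnth Z k & one_ok s].

Lemma ctx_same wi wf s s' : same wi wf s s' -> ctx s ->
  all (fun x => x \notin wi) [:: 0; vBIG]%N -> all (fun x => x \notin wf) [:: aZ; aONE]%N ->
  ctx s'.
Proof.
move=> [hi hf] [[c1 c2 c3] c4 c5 c6] /and3P[i1 i2 _] /and3P[f1 f2 _].
split; [by rewrite !hi|by rewrite hi| |by move=> a b; rewrite hf].
by move=> k; rewrite -c5; apply/matrixP => i j; rewrite !mxE hf.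
Qed.

Lemma ctx_exec c s : ctx s ->
  all (fun x => x \notin iwrites c) [:: 0; vBIG]%N ->
  all (fun x => x \notin fwrites c) [:: aZ; aONE]%N -> ctx (exec rt c s).
Proof. exact/ctx_same/exec_same. Qed.

Lemma ctxZ s (k : 'I_p) (i : 'I_m) (j : 'I_n) : ctx s -> flds s aZ k i j = tnth Z k i j.
Proof. by case=> _ _ /(_ k) <- _; rewrite mxE. Qed.

Lemma relationsP s : ctx s ->
  let s' := exec rt relations s in
  [/\ ctx s', ints s' vNX 0 = (p * n)%N &
    forall X, X \in span_of (read_mx p n s' aX) (p * n) <-> relation_of Z X].
Proof.
move=> cs; rewrite /relations exec_seqc /foldl.
have [bm bn bp bpn _] := big_int_le.
move E1: (exec rt _ s) => s1; move E2: (exec rt _ s1) => s2.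
move E3: (exec rt _ s2) => s3; move E4: (exec rt _ s3) => s4.
have [[hm hn hp] hB _ ho] := cs.
have c1 : ctx s1 by rewrite -E1; apply: ctx_exec.
have S1 : solved (fun _ : 'M_(p, n) => True) s1.
  by rewrite -E1; apply: solve_initP; rewrite ?hB // ltnW.
pose eqn (i : 'I_m) (X : 'M[K]_(p, n)) := \sum_u \sum_v X u v * tnth Z u i v.
pose I t st := ctx st /\ solved (fun X => forall i : 'I_m, (i < t)%N -> eqn i X = 0) st.
have : I m s2.
  have [[hm1 _ _] _ _ _] := c1.
  rewrite -E2 -[X in I X _]hm1 -[ints s1 0 0]/(neval s1 nM).
  apply: exec_for => [|t st lt [ci Si]].
    by split=> //; apply: solved_iff S1.
  have lt' : (t < m)%N by move: lt; rewrite /= hm1.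
  set si := tick 1 (set_int vI 0 t st).
  have csi : ctx si by [].
  have Ssi : solved (fun X => forall i : 'I_m, (i < t)%N -> eqn i X = 0) si by [].
  have ti : ints si vI 0 = t by [].
  clearbody si; split; first exact: ctx_exec.
  have [[_ hni hpi] _ _ _] := csi.
  apply: solved_iff (solve_eqnP (rt := rt) (eqn := eqn (Ordinal lt')) Ssi _ _ _) => //.
    move=> X; split=> [[h1 h2] i|h]; last by split=> [i l|]; apply: h => //; exact: ltnW.
    by rewrite ltnS leq_eqVlt => /orP[/eqP e|/h1//]; rewrite -h2; congr eqn; apply: val_inj.
  move=> X; apply: eq_bigr => u _; apply: eq_bigr => v _; congr (_ * _).
  rewrite mxE tset_flds //= hni hpi !ltn_ord /= big_ord1 /loopst /= ti.
  by rewrite (@ctxZ _ u (Ordinal lt') v csi).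
case=> c2 S2.
have [[_ hn2 hp2] hB2 _ _] := c2; have [[_ _ hR2 _] Q2 _] := S2.
have c3 : ctx s3 by rewrite -E3; apply: ctx_exec.
have X3 : span_of (read_mx p n s3 aX) (p * n) = span_of (read_mx p n s2 aB) (p * n).
  apply: eq_span_of => r lr; apply/matrixP => u v; rewrite !mxE -E3 tset_flds //.
  by rewrite /= hR2 hp2 hn2 lr !ltn_ord /= big_ord1 /loopst /= subn0.
split; first by rewrite -E4; apply: ctx_exec.
  by rewrite -E4 setv_ints /= -E3 exec_ints.
move=> X; have -> : span_of (read_mx p n s4 aX) (p * n) = span_of (read_mx p n s3 aX) (p * n).
  by apply: eq_span_of => r _; apply/matrixP => u v; rewrite !mxE -E4 exec_flds.
rewrite X3; apply: iff_trans (Q2 X) _.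
have E i : (\sum_k tnth Z k *m (row k X)^T) i 0 = eqn i X.
  rewrite summxE; apply: eq_bigr => u _; rewrite mxE; apply: eq_bigr => v _.
  by rewrite !mxE mulrC.
split=> [h|h i _]; last by rewrite -E h mxE.
by apply/colP => i; rewrite E h // mxE.
Qed.

Lemma algebraP s : ctx s -> ints s vNX 0 = (p * n)%N ->
  (forall X, X \in span_of (read_mx p n s aX) (p * n) <-> relation_of Z X) ->
  let s' := exec rt algebra s in
  [/\ ctx s', ints s' vNG 0 = (p * p)%N &
    forall c, c \in span_of (read_mx p p s' aG) (p * p) <->
      (forall x, relation_of Z x -> relation_of Z (c^T *m x))].
Proof.
move=> cs hNX hX; rewrite /algebra exec_seqc /foldl.
have [bm bn bp _ bpp] := big_int_le.
move E1: (exec rt _ s) => s1; move E2: (exec rt _ s1) => s2.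
move E3: (exec rt _ s2) => s3; move E4: (exec rt _ s3) => s4.
have [[hm hn hp] hB _ ho] := cs.
have c1 : ctx s1 by rewrite -E1; apply: ctx_exec.
have S1 : solved (fun _ : 'M_(p, p) => True) s1.
  by rewrite -E1; apply: solve_initP; rewrite ?hB // ltnW.
pose x := read_mx p n s aX.
pose eqn r (i : 'I_m) (c : 'M[K]_p) :=
  \sum_u \sum_v c u v * \sum_z tnth Z v i z * x r u z.
have x1 : read_mx p n s1 aX =1 x.
  by move=> r; apply/matrixP => u v; rewrite !mxE -E1 exec_flds.
(* The equations imposed so far are those before (r, t) in the lexicographic order of the two
   loops. *)
pose I r t st := [/\ ctx st, forall k, read_mx p n st aX k = x k &
  solved (fun c => forall a (i : 'I_m), (a < r)%N || (a == r) && (i < t)%N -> eqn a i c = 0) st].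
have : I (p * n)%N 0%N s2.
  have e1 : neval s1 (nvar vNX) = (p * n)%N by rewrite /= -E1 exec_ints.
  rewrite -E2 -e1; apply: (@exec_for _ rt (fun r st => I r 0%N st)).
    split=> //; apply: solved_iff S1 => c; split=> // _ a i; by rewrite ltn0 andbF orbF.
  move=> r st _ [ci xi Si].
  have {Si} : I r 0%N (tick 1 (set_int vX 0 r st)) by [].
  set si := tick 1 (set_int vX 0 r st) => Ii.
  have ri : ints si vX 0 = r by [].
  clearbody si; have [[[hmi _ _] _ _ _] _ _] := Ii.
  pose J t st := I r t st /\ ints st vX 0 = r.
  have {ci xi} : J m (exec rt (CFor vI nM (seqc
        [:: tset aF (NCst 0) (NCst 1) nP nP nN
              (FMul (FGet aZ (nvar vv) (nvar vI) (nvar vz)) (FGet aX (nvar vX) (nvar vu) (nvar vz)));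
            solve_step])) si).
    rewrite -[X in J X _]hmi -[ints si 0 0]/(neval si nM).
    apply: exec_for => // t st' lt [[cj xj Sj] rj].
    have lt' : (t < m)%N by move: lt; rewrite /= hmi.
    set sj := tick 1 (set_int vI 0 t st').
    have csj : ctx sj by [].
    have xsj k : read_mx p n sj aX k = x k by exact: xj.
    have Ssj : solved (fun c => forall a (i : 'I_m), (a < r)%N || (a == r) && (i < t)%N -> eqn a i c = 0) sj by [].
    have tj : ints sj vI 0 = t by [].
    have {}rj : ints sj vX 0 = r by [].
    clearbody sj; split; last by rewrite exec_ints.
    have [[_ hnj hpj] _ _ _] := csj.
    split; first exact: ctx_exec.
      by move=> k; rewrite -xsj; apply/matrixP => u v; rewrite !mxE exec_flds.
    apply: solved_iff (solve_eqnP (rt := rt) (eqn := eqn r (Ordinal lt')) Ssj _ _ _) => //.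
      move=> c; split=> [[h1 h2] a i|h].
        rewrite ltnS [(i <= t)%N]leq_eqVlt andb_orr orbCA => /orP[/andP[/eqP-> /eqP e]|/h1//].
        by rewrite -h2; congr eqn; apply: val_inj.
      split=> [a i /orP[l|/andP[e l]]|]; apply: h.
      - by rewrite l.
      - by rewrite e ltnS [(i <= t)%N]ltnW // orbT.
      - by apply/orP; right; rewrite eqxx /=.
    move=> c; apply: eq_bigr => u _; apply: eq_bigr => v _; congr (_ * _).
    rewrite mxE tset_flds //= hnj hpj !ltn_ord /=; apply: eq_bigr => z _.
    rewrite /loopst /= tj rj (@ctxZ _ v (Ordinal lt') z csj) -xsj mxE //.
  case=> -[c' x' S'] _; split=> //; apply: solved_iff S' => c.
  split=> h a i; last first.
    by case/orP=> [l|/andP[/eqP-> l]]; apply: h; rewrite ?ltnS ?leqnn // ltnW.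
  rewrite andbF orbF ltnS leq_eqVlt => /orP[e|l]; apply: h; by rewrite ?e ?ltn_ord ?l ?orbT.
case=> c2 x2 S2.
have [[_ hn2 hp2] hB2 _ _] := c2; have [[_ _ hR2 _] Q2 _] := S2.
have c3 : ctx s3 by rewrite -E3; apply: ctx_exec.
have X3 : span_of (read_mx p p s3 aG) (p * p) = span_of (read_mx p p s2 aB) (p * p).
  apply: eq_span_of => r lr; apply/matrixP => u v; rewrite !mxE -E3 tset_flds //.
  by rewrite /= hR2 hp2 lr !ltn_ord /= big_ord1 /loopst /= subn0.
split; first by rewrite -E4; apply: ctx_exec.
  by rewrite -E4 setv_ints /= -E3 exec_ints.
move=> c; have -> : span_of (read_mx p p s4 aG) (p * p) = span_of (read_mx p p s3 aG) (p * p).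
  by apply: eq_span_of => r _; apply/matrixP => u v; rewrite !mxE -E4 exec_flds.
rewrite X3; apply: iff_trans (Q2 c) _.
have E r i : (\sum_k tnth Z k *m (row k (c^T *m x r))^T) i 0 = eqn r i c.
  rewrite summxE /eqn exchange_big; apply: eq_bigr => v _ /=; rewrite mxE.
  under [RHS]eq_bigr => u _ do rewrite mulr_sumr.
  rewrite exchange_big; apply: eq_bigr => z _; rewrite mxE mxE mxE mulr_sumr.
  by apply: eq_bigr => u _; rewrite !mxE mulrCA.
split=> [h y /hX/span_ofP[d ->]|h a i].
  rewrite mulmx_sumr /relation_of.
  transitivity (\sum_r d r *: \sum_k tnth Z k *m (row k (c^T *m x r))^T).
    under [RHS]eq_bigr => r _ do rewrite scaler_sumr.
    rewrite exchange_big; apply: eq_bigr => k _ /=.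
    rewrite linear_sum linear_sum mulmx_sumr; apply: eq_bigr => r _ /=.
    by rewrite -scalemxAr !linearZ.
  apply: big1 => r _; suff -> : \sum_k tnth Z k *m (row k (c^T *m x r))^T = 0 by rewrite scaler0.
  by apply/colP => i; rewrite E h ?ltn_ord // mxE.
rewrite andbF orbF => l; rewrite -E h ?mxE //; apply/hX; exact: mem_span_of.
Qed.

End Algebra.

(** * Primitive idempotents *)

Notation vIT := 32%N (only parsing).
Notation vGI := 33%N (only parsing).
Notation vA := 34%N (only parsing).
Notation vB := 35%N (only parsing).
Notation vQ := 36%N (only parsing).
Notation vT := 37%N (only parsing).
Notation vNR := 38%N (only parsing).
Notation vD := 46%N (only parsing).
Notation aOUT := 1%N (only parsing).
Notation aE := 19%N (only parsing).
Notation aW := 20%N (only parsing).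
Notation aV := 21%N (only parsing).
Notation aPW := 22%N (only parsing).
Notation aH := 23%N (only parsing).
Notation aRT := 24%N (only parsing).
Notation aTMP := 25%N (only parsing).
Notation aTR := 26%N (only parsing).

Definition copy_mx (dst src : nat) : cmd :=
  tset dst (NCst 0) (NCst 1) nP nP (NCst 1) (fget2 src (nvar vu) (nvar vv)).

Definition powers : cmd := seqc
  [:: tset aPW (NCst 0) (NCst 1) nP nP (NCst 1) (kron (nvar vu) (nvar vv));
      CFor vD nP (seqc
        [:: tset aTMP (NCst 0) (NCst 1) nP nP nP
              (FMul (FGet aPW (nvar vD) (nvar vu) (nvar vz)) (FGet aG (nvar vGI) (nvar vz) (nvar vv)));
            tset aPW (NAdd (nvar vD) (NCst 1)) (NCst 1) nP nP (NCst 1)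
              (fget2 aTMP (nvar vu) (nvar vv))])].

(** The unknowns are the p + 1 coefficients of a polynomial of degree at most p; there is one
    equation for each entry of its value at the generator. *)
Definition annihilators : cmd := seqc
  [:: powers; solve_init (NCst 1) (NAdd nP (NCst 1));
      CFor vA nP (CFor vB nP (seqc
        [:: tset aF (NCst 0) (NCst 1) (NCst 1) (nvar vDV) (NCst 1)
              (FGet aPW (nvar vv) (nvar vA) (nvar vB));
            solve_step]))].

(** No flag is kept: [c] runs once for every nonzero entry, so it must bear repetition; it may use
    [vA], [vB] as the position of such an entry. *)
Definition for_nonzero (arr : nat) (c : cmd) : cmd :=
  CFor vA nP (CFor vB nP
    (CIf (BFEq (fget2 arr (nvar vA) (nvar vB)) (FCst 0)) CSkip c)).

Definition kill_root : cmd := seqc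
  [:: tset aV (NCst 0) (NCst 1) nP nP nP
        (FMul (FAdd (FGet aG (nvar vGI) (nvar vu) (nvar vz))
                 (FOpp (FMul (FGet aRT (NCst 0) (NCst 0) (nvar vT)) (kron (nvar vu) (nvar vz)))))
              (fget2 aW (nvar vz) (nvar vv)));
      for_nonzero aV (copy_mx aW aV)].

(** All solution rows are tried, since elimination may have made some of them zero; these yield no
    roots. *)
Definition reduce_gen : cmd := seqc
  [:: annihilators;
      CFor vQ (nvar vR) (seqc
        [:: tset aH (NCst 0) (NCst 1) (NCst 1) (nvar vDV) (NCst 1)
              (FGet aB (nvar vQ) (NCst 0) (nvar vv));
            CRoots vNR aRT aH (nvar vDV);
            CFor vT (nvar vNR) kill_root])].

(** [aE] holds the sum of the idempotents not yet found. A multiple of a primitive one has rank 1,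
    so any nonzero row of it, applied to [Z], gives a hidden matrix up to scaling. Primitive
    idempotents have trace 1 in every characteristic. *)
Definition extract : cmd := seqc
  [:: copy_mx aW aE;
      CFor vGI (nvar vNG) reduce_gen;
      for_nonzero aW (tset aOUT (nvar vIT) (NCst 1) nM nN nP
        (FMul (fget2 aW (nvar vA) (nvar vz)) (FGet aZ (nvar vz) (nvar vu) (nvar vv))));
      tset aTR (NCst 0) (NCst 1) (NCst 1) (NCst 1) nP (fget2 aW (nvar vz) (nvar vz));
      tset aTMP (NCst 0) (NCst 1) nP nP (NCst 1)
        (FAdd (fget2 aE (nvar vu) (nvar vv))
          (FOpp (FMul (fget2 aW (nvar vu) (nvar vv)) (FInv (fget2 aTR (NCst 0) (NCst 0))))));
      copy_mx aE aTMP].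

Definition hidden_basis : cmd := seqc
  [:: tset aE (NCst 0) (NCst 1) nP nP (NCst 1) (kron (nvar vu) (nvar vv));
      CFor vIT nP extract].

Section Eigen.
Variables (K : fieldType) (rt : {poly K} -> seq K).
Hypothesis rtP : root_finder rt.
Implicit Types s : state K.

Let loopfree e := all (fun x => x \notin [:: vr; vu; vv; vz]%N) (nreads e).

Lemma tset_mx arr eb eu ev ew body U V s :
  [&& arr != aACC, aACC \notin freads body, arr \notin freads body &
      all loopfree [:: eb; eu; ev; ew]] ->
  neval s eu = U -> neval s ev = V ->
  read_mx U V (exec rt (tset arr eb (NCst 1) eu ev ew body) s) arr (neval s eb) =
  \matrix_(u, v) \sum_(z < neval s ew) feval (loopst s 0 u v z) body.
Proof.
case/and4P=> h1 h2 h3 /and5P[h4 h5 h6 h7 _] eU eV; apply/matrixP => u v.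
by rewrite !mxE tset_flds // eU eV !ltn_ord /= leqnn addn1 leqnn subnn.
Qed.

Lemma tset_other arr eb eu ev ew body U V s k :
  [&& arr != aACC, aACC \notin freads body, arr \notin freads body &
      all loopfree [:: eb; eu; ev; ew]] -> k != neval s eb ->
  read_mx U V (exec rt (tset arr eb (NCst 1) eu ev ew body) s) arr k = read_mx U V s arr k.
Proof.
case/and4P=> h1 h2 h3 /and5P[h4 h5 h6 h7 _] ne; apply/matrixP => u v.
by rewrite !mxE tset_flds //= addn1 ltnS -eqn_leq eq_sym (negbTE ne).
Qed.

Lemma read_mx_exec c s U V x k : x \notin fwrites c ->
  read_mx U V (exec rt c s) x k = read_mx U V s x k.
Proof. by move=> h; apply/matrixP => u v; rewrite !mxE exec_flds. Qed.

Lemma copy_mxE dst src s p : ints s 0 2 = p ->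
  [&& dst != aACC, aACC != src & dst != src] ->
  read_mx p p (exec rt (copy_mx dst src) s) dst 0 = read_mx p p s src 0.
Proof.
move=> hp /and3P[h1 h2 h3]; rewrite -[X in read_mx _ _ _ _ X = _]/(neval s (NCst 0)).
rewrite tset_mx //; last by rewrite /= h1 !inE h2 h3.
by apply/matrixP => u v; rewrite !mxE big_ord1.
Qed.

(** [J false] holds while [c] has not run, [J true] after any positive number of runs; ending with
    [false] certifies that the array is zero. *)
Lemma for_nonzeroP (J : bool -> state K -> Prop) arr c (A : nat -> nat -> K) p s :
  (forall b st, J b st -> ints st 0 2 = p /\ forall u v, flds st arr 0 u v = A u v) ->
  (forall b k st, J b st -> J b (tick k st)) ->
  (forall b t st, J b st -> J b (tick 1 (set_int vA 0 t st))) ->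
  (forall b t st, J b st -> J b (tick 1 (set_int vB 0 t st))) ->
  vA \notin iwrites c ->
  (forall b st, J b st -> (ints st vA 0 < p)%N -> (ints st vB 0 < p)%N ->
     A (ints st vA 0) (ints st vB 0) != 0 -> J true (exec rt c st)) ->
  J false s ->
  exists2 b, J b (exec rt (for_nonzero arr c) s) &
    ~~ b -> forall u v, (u < p)%N -> (v < p)%N -> A u v = 0.
Proof.
move=> hJ ht hA hB wA hc J0.
pose I t st := exists2 b, J b st &
  ~~ b -> forall u v, (u < t)%N -> (v < p)%N -> A u v = 0.
rewrite -/(I p _) /for_nonzero.
have [e0 _] := hJ _ _ J0; rewrite -[X in I X _]e0 -[ints s 0 2]/(neval s nP).
apply: exec_for => [|t st lt [b Jb zb]]; first by exists false => //; apply: ht.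
have {lt} lt : (t < p)%N by move: lt; rewrite /= e0.
pose I' t' st := ints st vA 0 = t /\ exists2 b, J b st &
  ~~ b -> forall u v, (u < t)%N && (v < p)%N || (u == t) && (v < t')%N -> A u v = 0.
have {Jb} := hA b t st Jb; have : ints (tick 1 (set_int vA 0 t st)) vA 0 = t by [].
move: (tick 1 _) => si ti Jb.
suff [_ [b' Jb' zb']] : I' p (exec rt (CFor vB nP
   (CIf (BFEq (fget2 arr (nvar vA) (nvar vB)) (FCst 0)) CSkip c)) si).
  exists b' => // nb u v; rewrite ltnS leq_eqVlt => /orP[/eqP->|h] lv; apply: zb' => //.
    by rewrite eqxx lv orbT.
  by rewrite h lv.
have [e1 _] := hJ _ _ Jb; rewrite -[X in I' X _]e1 -[ints si 0 2]/(neval si nP).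
apply: exec_for => [|t' st' lt' [tj [b' Jb' zb']]].
  split=> //; exists b; first exact: ht.
  by move=> nb u v; rewrite andbF orbF => /andP[]; apply: zb.
have {lt'} lt' : (t' < p)%N by move: lt'; rewrite /= e1.
have {Jb'} := hB b' t' st' Jb'; have : ints (tick 1 (set_int vB 0 t' st')) vB 0 = t' by [].
have {tj} : ints (tick 1 (set_int vB 0 t' st')) vA 0 = t by [].
move: (tick 1 _) => sj tj tj' Jb'; have [_ eA] := hJ _ _ Jb'.
rewrite /exec -/exec; set k := (bcost _ _).+1.
have {}Jb' := ht _ k _ Jb'.
have [z|nz] : beval sj (BFEq (fget2 arr (nvar vA) (nvar vB)) (FCst 0)) \/
    ~~ beval sj (BFEq (fget2 arr (nvar vA) (nvar vB)) (FCst 0)) by case: beval; auto.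
  rewrite z; split=> //; exists b'; first exact: (ht _ 1%N _ Jb').
  move=> nb u v; rewrite ltnS [(v <= _)%N]leq_eqVlt andb_orr orbCA.
  case/orP=> [/andP[/eqP-> /eqP->]|]; last exact: zb'.
  by move: z; rewrite /= eA tj tj' => /eqP.
rewrite (negbTE nz); split; first by rewrite exec_ints.
by exists true => //; apply: (hc b') => //=; rewrite ?tj ?tj' //; move: nz; rewrite /= eA tj tj'.
Qed.

Variables (m n p : nat) (V : {vspace 'M[K]_(m, n)}) (M Z : p.-tuple 'M[K]_(m, n)).
Hypothesis basisM : basis_of V M.
Hypothesis basisZ : basis_of V Z.
Variables (G : nat -> 'M[K]_p) (w : nat -> 'rV[K]_p).
Hypothesis GE : forall g, (g < p * p)%N -> G g = hdiag M Z (w g).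
Local Notation ctx := (ctx Z).

Definition gctx s : Prop :=
  [/\ ctx s, ints s vNG 0 = (p * p)%N & forall g, read_mx p p s aG g = G g].

Lemma gctx_exec c s : gctx s ->
  all (fun x => x \notin iwrites c) [:: 0; vBIG; vNG]%N ->
  all (fun x => x \notin fwrites c) [:: aZ; aONE; aG]%N -> gctx (exec rt c s).
Proof.
case=> c1 c2 c3 /and4P[h1 h2 h3 _] /and4P[h4 h5 h6 _]; split.
- by apply: ctx_exec => //=; rewrite ?h1 ?h2 ?h4 ?h5.
- by rewrite exec_ints.
- by move=> g; rewrite read_mx_exec.
Qed.

Lemma powersP s g : gctx s -> ints s vGI 0 = g -> (g < p * p)%N ->
  forall d, (d <= p)%N -> read_mx p p (exec rt powers s) aPW d =
    hdiag M Z (\row_i (w g 0 i) ^+ d).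
Proof.
move=> gs hg lg; rewrite /powers exec_seqc /foldl.
have g1 : gctx (exec rt (tset aPW (NCst 0) (NCst 1) nP nP (NCst 1) (kron (nvar vu) (nvar vv))) s).
  exact: gctx_exec.
move E1: (exec rt _ s) g1 => s1 g1.
have hg1 : ints s1 vGI 0 = g by rewrite -E1 exec_ints.
pose I t st := [/\ gctx st, ints st vGI 0 = g & forall d, (d <= t)%N ->
  read_mx p p st aPW d = hdiag M Z (\row_i (w g 0 i) ^+ d)].
suff [] : I p (exec rt (CFor vD nP (seqc
        [:: tset aTMP (NCst 0) (NCst 1) nP nP nP
              (FMul (FGet aPW (nvar vD) (nvar vu) (nvar vz)) (FGet aG (nvar vGI) (nvar vz) (nvar vv)));
            tset aPW (NAdd (nvar vD) (NCst 1)) (NCst 1) nP nP (NCst 1)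
              (fget2 aTMP (nvar vu) (nvar vv))])) s1) by [].
have [[[_ _ hp1] _ _ _] _ _] := g1.
rewrite -[X in I X _]hp1 -[ints s1 0 2]/(neval s1 nP).
apply: exec_for => [|t st _ [gt hgt IH]].
  split=> // -[|//] _; have [[[_ _ hp] _ _ ho] _ _] := gs.
  have -> : \row_i (w g 0 i) ^+ 0 = const_mx 1 by apply/rowP => i; rewrite !mxE expr0.
  rewrite (hdiag1 basisM basisZ) -[X in read_mx _ _ _ _ X]/(neval s (NCst 0)).
  apply/matrixP => u v; rewrite -[tick _ _]/(tick _ s1) mxE /= -E1 tset_flds //= hp !ltn_ord /=.
  by rewrite big_ord1 /loopst /= ho !subn_eq0 -eqn_leq !mxE.
have {gt} : gctx (tick 1 (set_int vD 0 t st)) by [].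
have {hgt} : ints (tick 1 (set_int vD 0 t st)) vGI 0 = g by [].
have {IH} : forall d, (d <= t)%N ->
  read_mx p p (tick 1 (set_int vD 0 t st)) aPW d = hdiag M Z (\row_i (w g 0 i) ^+ d) by [].
have : ints (tick 1 (set_int vD 0 t st)) vD 0 = t by [].
move: (tick 1 _) => si ti IH hgi gi; rewrite exec_seqc /foldl.
have [[[_ _ hp] _ _ _] _ hG] := gi.
move E2: (exec rt _ si) => s2; have hp2 : ints s2 0 2 = p by rewrite -E2 exec_ints.
have t2 : ints s2 vD 0 = t by rewrite -E2 exec_ints.
have tmp : read_mx p p s2 aTMP 0 = hdiag M Z (\row_i (w g 0 i) ^+ t.+1).
  have -> : \row_i (w g 0 i) ^+ t.+1 = \row_i ((\row_i (w g 0 i) ^+ t) 0 i * w g 0 i).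
    by apply/rowP => i; rewrite !mxE exprSr.
  rewrite -(hdiag_mul basisM basisZ) -GE // -hG -IH // -[X in read_mx _ _ _ _ X = _]/(neval si (NCst 0)).
  rewrite -E2 tset_mx //; apply/matrixP => u v; rewrite !mxE /= hp.
  by apply: eq_bigr => z _; rewrite !mxE /loopst /= ti hgi.
split; first by apply: gctx_exec => //; rewrite -E2; apply: gctx_exec.
  by rewrite exec_ints // -E2 exec_ints.
move=> d; rewrite leq_eqVlt => /orP[/eqP->|ld].
  rewrite -tmp -(addn1 t) -[X in read_mx _ _ _ _ (X + 1)%N = _]t2.
  rewrite -[(ints s2 vD 0 + 1)%N]/(neval s2 (NAdd (nvar vD) (NCst 1))) tset_mx //.
  by apply/matrixP => u v; rewrite !mxE big_ord1 /loopst.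
rewrite tset_other //; last by rewrite /= t2 addn1 neq_ltn ld.
by rewrite -E2 read_mx_exec // IH.
Qed.

Definition row_poly s q : {poly K} := \poly_(v < p.+1) flds s aB q 0 v.

(** A polynomial P takes [hdiag w] to the diagonal map with weights P(w_i), so it annihilates
    exactly when every w_i is a root. *)
Lemma annihilatorsP s g : gctx s -> ints s vGI 0 = g -> (g < p * p)%N -> (0 < p)%N ->
  let s' := exec rt annihilators s in
  [/\ ints s' vR 0 = p.+1, ints s' vDV 0 = p.+1,
      forall q, (q < p.+1)%N -> forall i, root (row_poly s' q) (w g 0 i) &
      exists2 q, (q < p.+1)%N & row_poly s' q != 0].
Proof.
move=> gs hg lg p0; rewrite /annihilators exec_seqc /foldl.
have := powersP gs hg lg; have : gctx (exec rt powers s) by apply: gctx_exec.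
move: (exec rt powers s) => s1 g1 pw1.
have [bm bn bp bpn _] := @big_int_le m n p.
have [[[_ _ hp] hB _ ho] _ _] := g1.
have S1 : solved (fun _ : 'M_(1, p.+1) => True) (exec rt (solve_init (NCst 1) (NAdd nP (NCst 1))) s1).
  apply: solve_initP => //; rewrite ?hB ?mul1n //; first by move=> v; rewrite /= hp addn1.
have [g2 pw2] : gctx (exec rt (solve_init (NCst 1) (NAdd nP (NCst 1))) s1) /\
    forall d, read_mx p p (exec rt (solve_init (NCst 1) (NAdd nP (NCst 1))) s1) aPW d = read_mx p p s1 aPW d.
  by split; [apply: gctx_exec|move=> d; apply: read_mx_exec].
move: (exec rt (solve_init _ _) s1) S1 g2 pw2 => s2 S2 g2 pw2.
pose eqn (a b : 'I_p) (X : 'M[K]_(1, p.+1)) := \sum_u \sum_(v < p.+1) X u v * read_mx p p s1 aPW v a b.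
pose I t t' st := [/\ gctx st, forall d, read_mx p p st aPW d = read_mx p p s1 aPW d &
  solved (fun X => forall a b : 'I_p, (a < t)%N || (a == t :> nat) && (b < t')%N -> eqn a b X = 0) st].
set body := seqc _.
have : I p 0%N (exec rt (CFor vA nP (CFor vB nP body)) s2).
  have [[[_ _ hp2] _ _ _] _ _] := g2.
  have e2 : neval s2 nP = p by rewrite /= hp2.
  rewrite -[X in I X _ _]e2; apply: (@exec_for _ rt (fun t st => I t 0%N st)).
    by split=> //; apply: solved_iff S2 => X; split=> // _ a b; rewrite ltn0 andbF orbF.
  move=> t st lt It; have {lt} lt : (t < p)%N by rewrite -[X in (_ < X)%N]e2.
  have {It} : I t 0%N (tick 1 (set_int vA 0 t st)) by [].
  have : ints (tick 1 (set_int vA 0 t st)) vA 0 = t by [].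
  move: (tick 1 _) => si ti Ii; have [[[[_ _ hpi] _ _ _] _ _] _ _] := Ii.
  have ei : neval si nP = p by rewrite /= hpi.
  pose J t' st := I t t' st /\ ints st vA 0 = t.
  have : J p (exec rt (CFor vB nP body) si).
    rewrite -[X in J X _]ei; apply: exec_for => // t' st' lt' Jt.
    have {lt'} lt' : (t' < p)%N by rewrite -[X in (_ < X)%N]ei.
    have {Jt} : J t' (tick 1 (set_int vB 0 t' st')) by [].
    have : ints (tick 1 (set_int vB 0 t' st')) vB 0 = t' by [].
    move: (tick 1 _) => sj tj' [[gj pwj Sj] tj]; split; last by rewrite exec_ints.
    split; first exact: gctx_exec.
      by move=> d; rewrite -pwj; apply: read_mx_exec.
    have [[_ hvj _ _] _ _] := Sj.
    apply: solved_iff (solve_eqnP (rt := rt) (eqn := eqn (Ordinal lt) (Ordinal lt')) Sj _ _ _) => //.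
      move=> X; split=> [[h1 h2] a b|h].
        rewrite ltnS [(b <= _)%N]leq_eqVlt andb_orr orbCA => /orP[/andP[/eqP e1 /eqP e3]|/h1//].
        by rewrite -h2; congr eqn; apply: val_inj.
      split=> [a b /orP[l|/andP[e l]]|]; apply: h.
      - by rewrite l.
      - by rewrite e ltnS [(b <= t')%N]ltnW // orbT.
      - by apply/orP; right; rewrite eqxx /=.
    move=> X; apply: eq_bigr => u _; apply: eq_bigr => v _; congr (_ * _).
    rewrite mxE tset_flds //= hvj !ltn_ord /= big_ord1 /loopst /= tj tj'.
    by rewrite -pwj mxE.
  case=> -[c' x' S'] _; split=> //; apply: solved_iff S' => c.
  split=> h a b; last first.
    by case/orP=> [l|/andP[/eqP e l]]; apply: h; rewrite ?e ?ltnS ?leqnn // ltnW.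
  rewrite andbF orbF ltnS leq_eqVlt => /orP[e|l]; apply: h; by rewrite ?e ?ltn_ord ?l ?orbT.
move: (exec rt _ s2) => s3 [g3 pw3 [[_ hv hR _] Q3 _]]; rewrite mul1n in hR Q3.
have Q X : X \in span_of (read_mx 1 p.+1 s3 aB) p.+1 <->
    forall i, \sum_(v < p.+1) X 0 v * w g 0 i ^+ v = 0.
  apply: iff_trans (Q3 X) _.
  have E : \sum_(v < p.+1) X 0 v *: read_mx p p s1 aPW v =
      hdiag M Z (\row_i \sum_(v < p.+1) X 0 v * w g 0 i ^+ v).
    have hD := hdiag_lin M Z; have h0 := hdiag0 M Z.
    have -> : \row_i \sum_(v < p.+1) X 0 v * w g 0 i ^+ v =
        \sum_(v < p.+1) X 0 v *: \row_i (w g 0 i) ^+ v.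
      by apply/rowP => i; rewrite summxE mxE; apply: eq_bigr => v _; rewrite !mxE.
    rewrite (big_morph (hdiag M Z) (id1 := 0) (op1 := +%R)) //; last first.
      by move=> x y; have := hD 1 x y; rewrite !scale1r.
    apply: eq_bigr => v _; rewrite pw1 ?leq_ord //.
    by have := hD (X 0 v) (\row_i w g 0 i ^+ v) 0; rewrite h0 !addr0.
  have E' a b : eqn a b X = (\sum_(v < p.+1) X 0 v *: read_mx p p s1 aPW v) a b.
    by rewrite /eqn big_ord1 summxE; apply: eq_bigr => v _; rewrite [RHS]mxE.
  split=> [h i|h a b _].
    have /(hdiag_eq0 basisM basisZ)/rowP/(_ i) :
        hdiag M Z (\row_i \sum_(v < p.+1) X 0 v * w g 0 i ^+ v) = 0.
      by rewrite -E; apply/matrixP => a b; rewrite -E' h ?ltn_ord // mxE.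
    by rewrite !mxE.
  rewrite E' E (_ : \row_i _ = 0) ?hdiag0 ?mxE //.
  by apply/rowP => i; rewrite mxE h mxE.
have evalP q x : (row_poly s3 q).[x] = \sum_(v < p.+1) read_mx 1 p.+1 s3 aB q 0 v * x ^+ v.
  by rewrite horner_poly; apply: eq_bigr => v _; rewrite mxE.
split=> //.
  move=> q lq i; rewrite /root evalP; apply/eqP.
  by have /Q := mem_span_of (read_mx 1 p.+1 s3 aB) lq; apply.
(* A monic solution with p + 1 coefficients: it is nonzero, so the rows spanning the solutions
   cannot all be zero. *)
pose P := \prod_(i < p) ('X - (w g 0 i)%:P).
have sP : size P = p.+1 by rewrite size_prod_XsubC -[index_enum _]enumT size_enum_ord.
pose X : 'M[K]_(1, p.+1) := \row_v P`_v.
have /span_ofP[c Xc] : X \in span_of (read_mx 1 p.+1 s3 aB) p.+1.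
  apply/Q => i; transitivity P.[w g 0 i].
    by rewrite horner_coef sP; apply: eq_bigr => v _; rewrite mxE.
  by rewrite /P horner_prod (bigD1 i) //= !hornerE subrr mul0r.
have : [exists q : 'I_p.+1, row_poly s3 q != 0].
  apply: contraT; rewrite negb_exists => /forallP h.
  suff X0 : X = 0.
    have /eqP : lead_coef P = 0 by rewrite lead_coefE sP; have /rowP/(_ ord_max) := X0; rewrite !mxE.
    by rewrite lead_coef_eq0 -size_poly_eq0 sP.
  rewrite Xc; apply: big1 => q _; suff -> : read_mx 1 p.+1 s3 aB q = 0 by rewrite scaler0.
  apply/matrixP => u v; rewrite !mxE ord1; have /negPn/eqP/(congr1 (fun P : {poly K} => P`_v)) := h q.
  by rewrite coef_poly ltn_ord coef0.
by case/existsP=> q nq; exists q.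
Qed.

Definition sub_supp (a' a : 'rV[K]_p) := forall i, a' 0 i != 0 -> a 0 i != 0.

(* The part of W on the eigenspace of G g for the eigenvalue l is either zero
   or everything. *)
Definition handled g (l : K) (a : 'rV[K]_p) :=
  forall i j, a 0 i != 0 -> a 0 j != 0 -> w g 0 i = l -> w g 0 j = l.

Definition reduced s (a : 'rV[K]_p) (Q : 'rV[K]_p -> Prop) :=
  exists a', [/\ read_mx p p s aW 0 = hdiag M Z a', a' != 0, sub_supp a' a & Q a'].

Lemma handled_sub g l a a' : sub_supp a' a -> handled g l a -> handled g l a'.
Proof. by move=> h H i j /h hi /h hj; apply: H. Qed.

Lemma reduced_trans s s' a Q (Q' Q'' : 'rV[K]_p -> Prop) : reduced s a Q ->
  (forall a1, read_mx p p s aW 0 = hdiag M Z a1 -> a1 != 0 -> reduced s' a1 Q') ->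
  (forall a1 a2, sub_supp a2 a1 -> Q a1 -> Q' a2 -> Q'' a2) -> reduced s' a Q''.
Proof.
move=> [a1 [h1 h2 h3 h4]] H hQ; have [a2 [k1 k2 k3 k4]] := H _ h1 h2.
by exists a2; split=> //; [move=> i /k3/h3|apply: hQ k3 h4 k4].
Qed.

(** The weights are multiplied by w_i - l. If the result is nonzero, the new support avoids the
    eigenvalue l; if it is zero, the whole support has eigenvalue l. *)
Lemma kill_rootP s g a : gctx s -> ints s vGI 0 = g -> (g < p * p)%N ->
  read_mx p p s aW 0 = hdiag M Z a -> a != 0 ->
  reduced (exec rt kill_root s) a (handled g (flds s aRT 0 0 (ints s vT 0))).
Proof.
move=> gs hg lg hW a0; rewrite /kill_root exec_seqc /foldl; set l := flds s aRT _ _ _.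
pose b : 'rV[K]_p := \row_i ((w g 0 i - l) * a 0 i).
have [[[_ _ hp] _ _ ho] _ hG] := gs.
move E1: (exec rt (tset _ _ _ _ _ _ _) s) => s1.
have g1 : gctx s1 by rewrite -E1; apply: gctx_exec.
have W1 : read_mx p p s1 aW 0 = hdiag M Z a by rewrite -E1 read_mx_exec.
have V1 : read_mx p p s1 aV 0 = hdiag M Z b.
  have -> : hdiag M Z b = (G g - l%:M) *m read_mx p p s aW 0.
    rewrite hW GE // -scalemx1 -(hdiag1 basisM basisZ) -scaleNr addrC -hdiag_lin.
    rewrite (hdiag_mul basisM basisZ); congr hdiag; apply/rowP => i.
    by rewrite !mxE mulr1 addrC.
  rewrite -E1 -[X in read_mx _ _ _ _ X = _]/(neval s (NCst 0)) tset_mx //.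
  apply/matrixP => u v; rewrite !mxE /= hp; apply: eq_bigr => z _.
  rewrite /loopst /= !mxE -/l -hG hg mxE ho !subn_eq0 -eqn_leq.
  by rewrite -[l *+ _]mulr_natr.
pose J (d : bool) st := [/\ gctx st, forall u v, flds st aV 0 u v = flds s1 aV 0 u v,
  read_mx p p st aW 0 = hdiag M Z (if d then b else a) & d -> b != 0].
have [|||||||d [_ _ hd bn] z] := @for_nonzeroP J aV (copy_mx aW aV) (fun u v => flds s1 aV 0 u v) p s1.
- by move=> d st [[[[_ _ ?] _ _ _] _ _] ? _ _].
- by move=> d k st H; exact: H.
- by move=> d k st H; exact: H.
- by move=> d k st H; exact: H.
- by [].
- move=> d st [gt hv _ _] lA lB nz; split; first exact: gctx_exec.
  + by move=> u v; rewrite exec_flds.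
  + rewrite copy_mxE //; last by case: gt => [[[_ _ ->]]].
    by rewrite -V1; apply/matrixP => u v; rewrite !mxE hv.
  + move=> _; apply: contraNneq nz => b0; move: V1; rewrite b0 hdiag0.
    by move/matrixP/(_ (Ordinal lA) (Ordinal lB)); rewrite !mxE => ->.
- by split.
have b0 : ~~ d -> b = 0.
  move=> nd; apply: (hdiag_eq0 basisM basisZ); rewrite -V1; apply/matrixP => u v.
  by rewrite !mxE z.
case: d hd bn {z} b0 => hd bn b0.
  exists b; split=> //; [exact: bn|by move=> i; rewrite mxE mulf_eq0 negb_or => /andP[]|].
  by move=> i j; rewrite !mxE mulf_eq0 subr_eq0 negb_or => /andP[/eqP ne _] _ /ne.
exists a; split=> // i j ai aj _; apply/eqP; rewrite -subr_eq0.
by have /rowP/(_ j)/eqP := b0 isT; rewrite !mxE mulf_eq0 (negbTE aj) orbF.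
Qed.

(** Every w_i is a root of the nonzero annihilating row, hence gets handled, and stays so because
    supports only shrink. Roots that are not eigenvalues do no harm. *)
Lemma reduce_genP s g a : gctx s -> ints s vGI 0 = g -> (g < p * p)%N ->
  read_mx p p s aW 0 = hdiag M Z a -> a != 0 -> (0 < p)%N ->
  reduced (exec rt reduce_gen s) a
    (fun a' => forall i j, a' 0 i != 0 -> a' 0 j != 0 -> w g 0 i = w g 0 j).
Proof.
move=> gs hg lg hW a0 p0; rewrite /reduce_gen exec_seqc /foldl.
have := annihilatorsP gs hg lg p0; have : gctx (exec rt annihilators s) by apply: gctx_exec.
have : ints (exec rt annihilators s) vGI 0 = g by rewrite exec_ints.
have : read_mx p p (exec rt annihilators s) aW 0 = hdiag M Z a by rewrite read_mx_exec.
move: (exec rt annihilators s) => s1 W1 hg1 g1 [R1 DV1 rootP [q0 lq0 nq0]].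
pose P := row_poly s1.
pose st_ok st := [/\ gctx st, ints st vGI 0 = g, ints st vDV 0 = p.+1 &
  forall q v, flds st aB q 0 v = flds s1 aB q 0 v].
pose I t st := st_ok st /\ reduced st a
  (fun a' => forall q l, (q < t)%N -> l \in rt (P q) -> handled g l a').
set body := seqc _.
suff [_ [a' [h1 h2 h3 h4]]] : I p.+1 (exec rt (CFor vQ (nvar vR) body) s1).
  exists a'; split=> // i j ai aj; have li : w g 0 i \in rt (P q0).
    by have [_ ->] := rtP (P q0); rewrite nq0 rootP.
  by rewrite (h4 _ _ lq0 li _ _ ai aj).
have e1 : neval s1 (nvar vR) = p.+1 by [].
rewrite -[X in I X _]e1; apply: exec_for => [|t st _ It].
  by split=> //; exists a; split=> // q l; rewrite ltn0.
have {It} : I t (tick 1 (set_int vQ 0 t st)) by [].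
have : ints (tick 1 (set_int vQ 0 t st)) vQ 0 = t by [].
move: (tick 1 _) => s2 t2 [[g2 hg2 DV2 B2] r2]; rewrite /body exec_seqc /foldl.
move E3: (exec rt (tset _ _ _ _ _ _ _) s2) => s3.
have g3 : gctx s3 by rewrite -E3; apply: gctx_exec.
have hg3 : ints s3 vGI 0 = g by rewrite -E3 exec_ints.
have DV3 : ints s3 vDV 0 = p.+1 by rewrite -E3 exec_ints.
have B3 q v : flds s3 aB q 0 v = flds s1 aB q 0 v by rewrite -E3 exec_flds.
have W3 : read_mx p p s3 aW 0 = read_mx p p s2 aW 0 by rewrite -E3 read_mx_exec.
have H3 : \poly_(v < ints s3 vDV 0) flds s3 aH 0 0 v = P t.
  rewrite DV3; apply/polyP => v; rewrite !coef_poly; case: ifP => // lv.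
  by rewrite -E3 tset_flds //= DV2 lv /= big_ord1 /loopst /= t2 B2.
move E4: (exec rt (CRoots _ _ _ _) s3) => s4.
have g4 : gctx s4 by rewrite -E4; apply: gctx_exec.
have hg4 : ints s4 vGI 0 = g by rewrite -E4 exec_ints.
have DV4 : ints s4 vDV 0 = p.+1 by rewrite -E4 exec_ints.
have B4 q v : flds s4 aB q 0 v = flds s1 aB q 0 v by rewrite -E4 exec_flds.
have W4 : read_mx p p s4 aW 0 = read_mx p p s2 aW 0 by rewrite -E4 read_mx_exec.
have N4 : ints s4 vNR 0 = size (rt (P t)) by rewrite -E4 -H3.
have RT4 k : (k < size (rt (P t)))%N -> flds s4 aRT 0 0 k = (rt (P t))`_k.
  by rewrite -H3 => lk; rewrite -E4 /exec /= lk.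
pose I' t' st := [/\ st_ok st, forall k, flds st aRT 0 0 k = flds s4 aRT 0 0 k &
  reduced st a (fun a' =>
    (forall q l, (q < t)%N -> l \in rt (P q) -> handled g l a') /\
    (forall k, (k < t')%N -> handled g (flds s4 aRT 0 0 k) a'))].
have : I' (size (rt (P t))) (exec rt (CFor vT (nvar vNR) kill_root) s4).
  have e4 : neval s4 (nvar vNR) = size (rt (P t)) by [].
  rewrite -[X in I' X _]e4; apply: exec_for => [|t' st' _ It'].
    split=> //; case: r2 => a' [h1 h2 h3 h4]; exists a'; split=> //.
    by rewrite [LHS]W4.
  have {It'} : I' t' (tick 1 (set_int vT 0 t' st')) by [].
  have : ints (tick 1 (set_int vT 0 t' st')) vT 0 = t' by [].
  move: (tick 1 _) => s5 t5 [[g5 hg5 DV5 B5] RT5 r5]; split.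
  - split; [exact: gctx_exec|by rewrite exec_ints|by rewrite exec_ints|].
    by move=> q v; rewrite exec_flds.
  - by move=> k; rewrite exec_flds.
  - apply: (reduced_trans r5) => [a1 h1 h2|a1 a2 h12 [k1 k2] k3].
      exact: (kill_rootP g5 hg5 lg h1 h2).
    split=> [q l lq lin|k]; first by apply: handled_sub h12 _; apply: k1 lq lin.
    rewrite ltnS leq_eqVlt => /orP[/eqP->|lk]; last exact: handled_sub h12 (k2 _ lk).
    by rewrite -RT5 -t5.
case=> h1 _ [a' [k1 k2 k3 [k4 k5]]]; split=> //; exists a'; split=> // q l.
rewrite ltnS leq_eqVlt => /orP[/eqP->|lq]; last exact: k4.
by move=> /(nthP 0)[k lk <-]; rewrite -RT4 //; apply: k5.
Qed.

Hypothesis G_span : forall ww, hdiag M Z ww \in span_of G (p * p).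

(** The generators span all diagonal maps, including the i-th idempotent. If all of them agree at i
    and j, so does that idempotent, whence i = j. *)
Lemma supp_unique (a : 'rV[K]_p) :
  (forall g i j, (g < p * p)%N -> a 0 i != 0 -> a 0 j != 0 -> w g 0 i = w g 0 j) ->
  forall i, a 0 i != 0 -> a = a 0 i *: delta_mx 0 i.
Proof.
move=> h i ai; have /span_ofP[c e] := G_span (delta_mx 0 i).
have d : delta_mx 0 i = \sum_(g < p * p) c g *: w g.
  apply/eqP; rewrite -subr_eq0; apply/eqP; apply: (hdiag_eq0 basisM basisZ).
  have hD := hdiag_lin M Z; have h0 := hdiag0 M Z.
  rewrite -scaleN1r addrC hD e.
  rewrite (big_morph (hdiag M Z) (id1 := 0) (op1 := +%R)) //; last first.
    by move=> x y; have := hD 1 x y; rewrite !scale1r.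
  rewrite scaleN1r addrC; apply/eqP; rewrite subr_eq0; apply/eqP; apply: eq_bigr => g _.
  by rewrite GE //; have := hD (c g) (w g) 0; rewrite h0 !addr0 => ->.
apply/rowP => j; rewrite !mxE eqxx /=; have [->|ji] := eqVneq j i; first by rewrite mulr1.
rewrite mulr0; apply/eqP; apply: contraT => aj.
have : (delta_mx 0 i : 'rV[K]_p) 0 j = (delta_mx 0 i : 'rV[K]_p) 0 i.
  rewrite d !summxE; apply: eq_bigr => g _; rewrite !mxE; congr (_ * _); exact: h.
by rewrite !mxE !eqxx (negbTE ji) => /eqP; rewrite eq_sym oner_eq0.
Qed.

Lemma extractP s t e : gctx s -> ints s vIT 0 = t -> (0 < p)%N ->
  read_mx p p s aE 0 = hdiag M Z e -> e != 0 ->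
  let s' := exec rt extract s in
  (forall k, k != t -> read_mx m n s' aOUT k = read_mx m n s aOUT k) /\
  exists i, [/\ e 0 i != 0, read_mx p p s' aE 0 = hdiag M Z (e - delta_mx 0 i) &
     exists2 b, b != 0 & read_mx m n s' aOUT t = b *: tnth M i].
Proof.
move=> gs ht p0 hE e0; rewrite /extract exec_seqc /foldl.
move E1: (exec rt _ s) => s1; move E2: (exec rt _ s1) => s2.
move E3: (exec rt _ s2) => s3; move E4: (exec rt _ s3) => s4.
move E5: (exec rt _ s4) => s5; move E6: (exec rt _ s5) => s6.
have g1 : gctx s1 by rewrite -E1; apply: gctx_exec.
have W1 : read_mx p p s1 aW 0 = hdiag M Z e.
  by rewrite -E1 copy_mxE //; case: gs => [[[_ _ ->]]].
pose I g st := gctx st /\ reduced st e (fun a => forall g' i j, (g' < g)%N ->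
   a 0 i != 0 -> a 0 j != 0 -> w g' 0 i = w g' 0 j).
have [g2 [a [W2 a0 ae aeq]]] : I (p * p)%N s2.
  have [_ hNG _] := g1; have e1 : neval s1 (nvar vNG) = (p * p)%N by [].
  rewrite -E2 -[X in I X _]e1; apply: exec_for => [|g st lt It].
    by split=> //; exists e; split=> // g' i j; rewrite ltn0.
  have {lt} lt : (g < p * p)%N by rewrite -[X in (_ < X)%N]e1.
  have {It} : I g (tick 1 (set_int vGI 0 g st)) by [].
  have : ints (tick 1 (set_int vGI 0 g st)) vGI 0 = g by [].
  move: (tick 1 _) => si gi [gci ri]; split; first exact: gctx_exec.
  apply: (reduced_trans ri) => [a1 h1 h2|a1 a2 h12 k1 k2].
    exact: (reduce_genP gci gi lt h1 h2 p0).
  move=> g' i j; rewrite ltnS leq_eqVlt => /orP[/eqP->|lg] hi hj; first exact: k2.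
  by apply: k1; rewrite ?h12.
have [i ai] := rV0Pn _ a0; have aE' := supp_unique (fun g i j h => aeq g i j h) ai.
have aj j : a 0 j = a 0 i * (j == i)%:R by rewrite {1}aE' !mxE eqxx.
have t2 : ints s2 vIT 0 = t by rewrite -E2 exec_ints // -E1 exec_ints.
have O2 k : read_mx m n s2 aOUT k = read_mx m n s aOUT k.
  by rewrite -E2 read_mx_exec // -E1 read_mx_exec.
pose J (d : bool) st := [/\ gctx st, ints st vIT 0 = t,
  forall u v, flds st aW 0 u v = flds s2 aW 0 u v,
  forall k, k != t -> read_mx m n st aOUT k = read_mx m n s aOUT k &
  d -> exists2 b, b != 0 & read_mx m n st aOUT t = b *: tnth M i].
have [|||||||d [g3 _ W3 O3 D3] z] := @for_nonzeroP J aW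
   (tset aOUT (nvar vIT) (NCst 1) nM nN nP
        (FMul (fget2 aW (nvar vA) (nvar vz)) (FGet aZ (nvar vz) (nvar vu) (nvar vv))))
   (fun u v => flds s2 aW 0 u v) p s2.
- by move=> d st [[[[_ _ ?] _ _ _] _ _] _ ? _ _].
- by move=> d k st H; exact: H.
- by move=> d k st H; exact: H.
- by move=> d k st H; exact: H.
- by [].
- move=> d st [gt tt hv Ot _] lA lB nz; split.
  + exact: gctx_exec.
  + by rewrite exec_ints.
  + by move=> u v; rewrite exec_flds.
  + by move=> k kt; rewrite tset_other ?Ot //= tt.
  + move=> _; have [[[hm hn hp] _ _ _] _ _] := gt; pose k := Ordinal lA.
    have Wk l : flds st aW 0 k (l : 'I_p) = hdiag M Z a k l by rewrite hv -W2 mxE.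
    (* Entry (k, l) of [W] is t_ki a_i (t^-1)_il, so a nonzero entry makes this factor nonzero. *)
    exists (transition M Z k i * a 0 i).
      apply: contraNneq nz => b0; rewrite -[flds s2 aW 0 _ _]/(flds s2 aW 0 k (Ordinal lB)).
      rewrite -hv Wk hdiagE; apply/eqP; apply: big1 => j _; rewrite aj.
      by have [->|_] := eqVneq j i; rewrite ?mulr1 ?b0 ?mul0r // !mulr0 mul0r.
    transitivity (\sum_l hdiag M Z a k l *: tnth Z l).
      rewrite -[X in read_mx _ _ _ _ X]tt -[ints st vIT 0]/(neval st (nvar vIT)) tset_mx //.
      apply/matrixP => u v; rewrite mxE summxE /= hp; apply: eq_bigr => l _.
      by rewrite /loopst /= -[ints st vA 0]/(nat_of_ord k) Wk [RHS]mxE; case: gt => ct _ _; rewrite (ctxZ _ _ _ ct).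
    rewrite (hdiag_row basisM basisZ) (bigD1 i) //= big1 ?addr0 // => j ji.
    by rewrite aj (negbTE ji) !mulr0 scale0r.
- by split.
rewrite E3 in g3 W3 O3 D3.
have {}D3 : exists2 b, b != 0 & read_mx m n s3 aOUT t = b *: tnth M i.
  apply: D3; apply: contraR a0 => nd; apply/eqP; apply: (hdiag_eq0 basisM basisZ).
  by rewrite -W2; apply/matrixP => u v; rewrite !mxE z.
have O6 k : read_mx m n s6 aOUT k = read_mx m n s3 aOUT k.
  by rewrite -E6 read_mx_exec // -E5 read_mx_exec // -E4 read_mx_exec.
split; first by move=> k kt; rewrite O6 O3.
exists i; split; [exact: ae| |by rewrite O6].
have {}W3 : read_mx p p s3 aW 0 = hdiag M Z a.
  by rewrite -W2; apply/matrixP => u v; rewrite !mxE W3.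
have g4 : gctx s4 by rewrite -E4; apply: gctx_exec.
have W4 : read_mx p p s4 aW 0 = hdiag M Z a by rewrite -E4 read_mx_exec.
have TR4 : flds s4 aTR 0 0 0 = a 0 i.
  have [[[_ _ hp] _ _ _] _ _] := g3.
  rewrite -E4 tset_flds //= hp /=.
  (* The trace is the sum of the weights, of which only a_i is nonzero. *)
  transitivity (\tr (hdiag M Z a)); last first.
    rewrite (hdiag_tr basisM basisZ) (bigD1 i) //= big1 ?addr0 // => j ji.
    by rewrite aj (negbTE ji) mulr0.
  by apply: eq_bigr => u _; rewrite -W3 mxE /loopst.
have E4' : read_mx p p s4 aE 0 = hdiag M Z e.
  by rewrite -E4 read_mx_exec // -E3 read_mx_exec // -E2 read_mx_exec // -E1 read_mx_exec.
have T5 : read_mx p p s5 aTMP 0 = hdiag M Z (e - delta_mx 0 i).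
  have -> : e - delta_mx 0 i = - (a 0 i)^-1 *: a + e.
    by rewrite {2}aE' scaleNr scalerA mulVf // scale1r addrC.
  rewrite hdiag_lin -W4 -E4' -[X in read_mx _ _ _ _ X = _]/(neval s4 (NCst 0)).
  have [[[_ _ hp] _ _ _] _ _] := g4.
  rewrite -E5 tset_mx //; apply/matrixP => u v; rewrite !mxE big_ord1 /loopst /= TR4.
  by rewrite mulNr [RHS]addrC [_ * (a 0 i)^-1]mulrC.
rewrite -E6 copy_mxE ?T5 //.
by rewrite -E5 exec_ints //; case: g4 => [[[_ _ ->]]].
Qed.

(** The invariant keeps the list [l] of indices found, with [aE] the sum of the idempotents outside
    it. Each new index has nonzero weight in [aE], hence is new; p distinct indices form the
    permutation. *)
Lemma hidden_basisP s : gctx s -> (0 < p)%N ->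
  exists sigma : 'S_p, forall k : 'I_p, exists2 a : K, a != 0 &
    read_mx m n (exec rt hidden_basis s) aOUT k = a *: tnth M (sigma k).
Proof.
move=> gs p0; rewrite /hidden_basis exec_seqc /foldl.
move E1: (exec rt (tset _ _ _ _ _ _ _) s) => s1.
have g1 : gctx s1 by rewrite -E1; apply: gctx_exec.
have hE : read_mx p p s1 aE 0 = hdiag M Z (const_mx 1).
  have [[[_ _ hp] _ _ ho] _ _] := gs.
  rewrite (hdiag1 basisM basisZ) -[X in read_mx _ _ _ _ X]/(neval s (NCst 0)).
  rewrite -E1 tset_mx //; apply/matrixP => u v; rewrite !mxE big_ord1 /loopst /= ho.
  by rewrite !subn_eq0 -eqn_leq.
pose i0 := Ordinal p0.
pose I t st := gctx st /\ exists l : seq 'I_p, [/\ size l = t, uniq l,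
  read_mx p p st aE 0 = hdiag M Z (\row_i (i \notin l)%:R) &
  forall k, (k < t)%N -> exists2 b, b != 0 & read_mx m n st aOUT k = b *: tnth M (nth i0 l k)].
have : I p (exec rt (CFor vIT nP extract) s1).
  have [[[_ _ hp] _ _ _] _ _] := g1; have e1 : neval s1 nP = p by [].
  rewrite -[X in I X _]e1; apply: exec_for => [|t st lt It].
    split=> //; exists [::]; split=> //; rewrite [LHS]hE; congr hdiag.
    by apply/rowP => i; rewrite !mxE.
  have {lt} lt : (t < p)%N by rewrite -[X in (_ < X)%N]e1.
  have {It} : I t (tick 1 (set_int vIT 0 t st)) by [].
  have : ints (tick 1 (set_int vIT 0 t st)) vIT 0 = t by [].
  move: (tick 1 _) => si ti [gi [l [sl ul El Ol]]]; split; first exact: gctx_exec.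
  (* Otherwise [l], of length t < p, would contain all p indices. *)
  have e0 : \row_i (i \notin l)%:R != 0 :> 'rV[K]_p.
    apply/eqP => /rowP h; have sub : {subset enum 'I_p <= l}.
      move=> i _; have := h i; rewrite !mxE; case: (i \in l) => // /eqP.
      by rewrite oner_eq0.
    by have := uniq_leq_size (enum_uniq _) sub; rewrite size_enum_ord sl leqNgt lt.
  have [O' [i [ei E' [b b0 Ob]]]] := extractP gi ti p0 El e0.
  have il : i \notin l by apply: contraNN ei => il; rewrite mxE il.
  exists (rcons l i); split.
  - by rewrite size_rcons sl.
  - by rewrite rcons_uniq il.
  - rewrite E'; congr hdiag; apply/rowP => j; rewrite !mxE mem_rcons inE eqxx /=.
    by have [->|_] := eqVneq j i; rewrite ?il ?subrr ?subr0.
  - move=> k; rewrite ltnS leq_eqVlt nth_rcons sl => /orP[/eqP->|lk].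
      by rewrite ltnn eqxx; exists b.
    rewrite lk O'; first exact: Ol.
    by rewrite neq_ltn lk.
case=> _ [l [sl ul _ Ol]].
have inj : injective (fun k : 'I_p => nth i0 l k).
  move=> j k /eqP; rewrite nth_uniq ?sl // => /eqP; exact: val_inj.
by exists (perm inj) => k; rewrite permE; apply: Ol.
Qed.

End Eigen.

(** * Matrices of minimal rank *)

Notation vNUM := 1%N (only parsing).
Notation vRK := 40%N (only parsing).
Notation vK := 41%N (only parsing).
Notation vRHO := 42%N (only parsing).
Notation aMIN := 2%N (only parsing).

(** The rank of A is the number of independent equations in X A^T = 0, left in [vCNT] by the
    solver. *)
Definition rank_of_output : cmd := seqc
  [:: solve_init (NCst 1) nN;
      CFor vI nM (seqc
        [:: tset aF (NCst 0) (NCst 1) (NCst 1) nN (NCst 1) (FGet aOUT (nvar vK) (nvar vI) (nvar vv));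
            solve_step])].

(** The search starts from n, which bounds every rank. *)
Definition min_rank : cmd := seqc
  [:: setv vRHO nN;
      CFor vK nP (seqc
        [:: rank_of_output;
            CNSet vRK (nvar vK) (nvar vCNT);
            CIf (BLeq (nvar vCNT) (nvar vRHO)) (setv vRHO (nvar vCNT)) CSkip])].

(** The result rho shares its cell with the input m, which the copying loop still needs; so it is
    moved there only at the end. *)
Definition select : cmd := seqc
  [:: setv vNUM (NCst 0);
      CFor vK nP (CIf (BLeq (NGet vRK (nvar vK)) (nvar vRHO))
        (seqc [:: tset aMIN (nvar vNUM) (NCst 1) nM nN (NCst 1)
                    (FGet aOUT (nvar vK) (nvar vu) (nvar vv));
                  setv vNUM (clip (NAdd (nvar vNUM) (NCst 1)))])
        CSkip);
      setv 0 (nvar vRHO)].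

Definition main_cmd : cmd := seqc [:: relations; algebra; hidden_basis; min_rank; select].

(* The inputs n and p are moved to the cells 1 and 2 of the integer array 0,
   because out_num shares its cell with the input n. *)
Definition init_cmd : cmd :=
  let e := NAdd (NAdd (NAdd nM nN) nP) (NCst 1) in
  seqc [:: CNSet 0 (NCst 1) (nvar 1); CNSet 0 (NCst 2) (nvar 2);
           setv vBIG (NMul e e); CFSet aONE (NCst 0) (NCst 0) (NCst 0) (FCst 1)].

Section MinRank.
Variables (K : fieldType) (m n p : nat) (V : {vspace 'M[K]_(m, n)}).
Variables (M : p.-tuple 'M[K]_(m, n)).
Hypothesis basisM : basis_of V M.
Hypothesis dir_col : directv (\sum_(i < p) Im (tnth M i))%VS.
Hypothesis dir_row : directv (\sum_(i < p) Im (tnth M i)^T)%VS.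
Variables (sigma : 'S_p) (A : 'I_p -> 'M[K]_(m, n)) (rho : nat).
Hypothesis AE : forall k, exists2 a : K, a != 0 & A k = a *: tnth M (sigma k).
Hypothesis rho_le : forall k, (rho <= \rank (A k))%N.
Hypothesis rho_ex : exists k, \rank (A k) = rho.

Lemma rankA k : \rank (A k) = \rank (tnth M (sigma k)).
Proof. by have [a a0 ->] := AE k; rewrite mxrank_scale_nz. Qed.

Lemma min_rankP : is_min_rank V rho.
Proof.
split=> [|X XV X0].
  have [k rk] := rho_ex; exists (A k); split=> //; have [a a0 ->] := AE k.
    by rewrite memvZ // (basis_mem basisM) ?mem_tnth.
  by rewrite scaler_eq0 negb_or a0 (hidden_neq0 basisM).
have : X \in <<M>>%VS by rewrite (span_basis basisM).
move/coord_span => e; have [i ai|z] := pickP (fun i => coord M i X != 0); last first.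
  by move: X0; rewrite e big1 ?eqxx // => i _; have /negbFE/eqP -> := z i; rewrite scale0r.
have -> : X = \sum_i coord M i X *: tnth M i.
  by rewrite {1}e; apply: eq_bigr => j _; rewrite -tnth_nth.
apply: leq_trans (hidden_comb_rank dir_col (a := fun i => coord M i X) ai).
by apply: leq_trans (rho_le (sigma^-1%g i)) _; rewrite rankA permKV.
Qed.

Lemma min_rank_unique X : X \in V ->
  \rank X = rho <-> exists k, (\rank (A k) <= rho)%N /\ exists2 a, a != 0 & X = a *: A k.
Proof.
move=> XV; split=> [rX|[k [rk [a a0 ->]]]]; last first.
  by rewrite mxrank_scale_nz //; apply/eqP; rewrite eqn_leq rk rho_le.
have : X \in <<M>>%VS by rewrite (span_basis basisM).
move/coord_span => e0; pose c i := coord M i X.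
have e : X = \sum_i c i *: tnth M i.
  by rewrite {1}e0; apply: eq_bigr => j _; rewrite -tnth_nth.
(* Excludes X = 0, which the rank equation alone does not. *)
have rho0 : (0 < rho)%N.
  have [k <-] := rho_ex; rewrite rankA lt0n mxrank_eq0; exact: (hidden_neq0 basisM).
have [i ai|z] := pickP (fun i => c i != 0); last first.
  move: rho0; rewrite -rX e big1 ?mxrank0 // => i _.
  by have /negbFE/eqP -> := z i; rewrite scale0r.
have le : (\rank (A (sigma^-1%g i)) <= rho)%N.
  by rewrite rankA permKV -rX e; apply: hidden_comb_rank.
(* A second nonzero coordinate j would push the rank of X strictly above that of M_j, hence above
   rho. *)
have cj j : j != i -> c j = 0.
  move=> ji; apply/eqP; apply: contraT => nj.
  have := hidden_comb_rank_lt basisM dir_col dir_row ji nj ai.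
  rewrite -e rX ltnNge; have := rho_le (sigma^-1%g j); by rewrite rankA permKV => ->.
exists (sigma^-1%g i); split=> //; have [b b0 ->] := AE (sigma^-1%g i).
exists (c i / b); first by rewrite mulf_neq0 ?invr_eq0.
rewrite permKV scalerA divfK // {1}e (bigD1 i) //= big1 ?addr0 // => j ji.
by rewrite cj // scale0r.
Qed.

End MinRank.

(** * Computing ranks and listing the matrices of minimal rank *)

Section Final.
Variables (K : fieldType) (rt : {poly K} -> seq K).
Hypothesis rtP : root_finder rt.
Variables (m n p : nat) (Z : p.-tuple 'M[K]_(m, n)).
Local Notation ctx := (ctx Z).
Implicit Types s : state K.

Lemma rank_of_outputP s k : ctx s -> ints s vK 0 = k ->
  ints (exec rt rank_of_output s) vCNT 0 = \rank (read_mx m n s aOUT k).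
Proof.
move=> cs hk; rewrite /rank_of_output exec_seqc /foldl.
have [bm bn bp _ _] := @big_int_le m n p; have [[hm hn hp] hB _ ho] := cs.
set A := read_mx m n s aOUT k.
pose eqn (i : 'I_m) (X : 'M[K]_(1, n)) := \sum_u \sum_v X u v * A i v.
pose I t st := [/\ ctx st, ints st vK 0 = k, read_mx m n st aOUT k = A &
  solved (fun X => forall i : 'I_m, (i < t)%N -> eqn i X = 0) st].
move E1: (exec rt (solve_init _ _) s) => s1.
have c1 : ctx s1 by rewrite -E1; apply: ctx_exec.
have k1 : ints s1 vK 0 = k by rewrite -E1 exec_ints.
have A1 : read_mx m n s1 aOUT k = A by rewrite -E1 read_mx_exec.
have S1 : solved (fun _ : 'M_(1, n) => True) s1.
  rewrite -E1; apply: solve_initP => //; rewrite ?hB ?mul1n //.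
have : I m (exec rt (CFor vI nM (seqc
        [:: tset aF (NCst 0) (NCst 1) (NCst 1) nN (NCst 1) (FGet aOUT (nvar vK) (nvar vI) (nvar vv));
            solve_step])) s1).
  have [[hm1 _ _] _ _ _] := c1; have e1 : neval s1 nM = m by [].
  rewrite -[X in I X _]e1; apply: exec_for => [|t st lt It].
    by split=> //; apply: solved_iff S1.
  have {lt} lt : (t < m)%N by rewrite -[X in (_ < X)%N]e1.
  have {It} : I t (tick 1 (set_int vI 0 t st)) by [].
  have : ints (tick 1 (set_int vI 0 t st)) vI 0 = t by [].
  move: (tick 1 _) => si ti [csi ki Ai Ssi]; split.
  - exact: ctx_exec.
  - by rewrite exec_ints.
  - by rewrite read_mx_exec.
  have [[_ hni _] _ _ _] := csi.
  apply: solved_iff (solve_eqnP (rt := rt) (eqn := eqn (Ordinal lt)) Ssi _ _ _) => //.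
    move=> X; split=> [[h1 h2] i|h]; last by split=> [i l|]; apply: h => //; exact: ltnW.
    by rewrite ltnS leq_eqVlt => /orP[/eqP e|/h1//]; rewrite -h2; congr eqn; apply: val_inj.
  move=> X; apply: eq_bigr => u _; apply: eq_bigr => v _; congr (_ * _).
  rewrite mxE tset_flds //= hni !ltn_ord /= big_ord1 /loopst /= ti ki.
  by rewrite -Ai mxE.
move: (exec rt _ s1) => s2 [_ _ _ [_ Q2]]; rewrite mul1n in Q2 *; move=> d2.
(* Compared with the count [d2] kept by the solver, this identifies [vCNT] with the rank. *)
have : (\dim (span_of (read_mx 1 n s2 aB) n) + \rank A^T = n)%N.
  apply: dim_kernel_rank => X; apply: iff_trans (Q2 X) _.
  have E i : (X *m A^T) 0 i = eqn i X.
    by rewrite mxE /eqn big_ord1; apply: eq_bigr => v _; rewrite mxE.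
  split=> [h|h i _]; last by rewrite -E h mxE.
  by apply/rowP => i; rewrite E h // mxE.
by rewrite mxrank_tr -[RHS in _ = RHS -> _]d2 => /addnI.
Qed.

Lemma min_rank_cmdP s : ctx s -> (0 < p)%N ->
  let s' := exec rt min_rank s in
  let A k := read_mx m n s aOUT k in
  [/\ forall k, (k < p)%N -> ints s' vRK k = \rank (A k),
      forall k, (k < p)%N -> (ints s' vRHO 0 <= \rank (A k))%N &
      exists2 k, (k < p)%N & \rank (A k) = ints s' vRHO 0].
Proof.
move=> cs p0 s' A; rewrite /s' /min_rank exec_seqc /foldl {s'}.
move E1: (exec rt (setv _ _) s) => s1.
have c1 : ctx s1 by rewrite -E1; apply: ctx_exec.
have A1 k : read_mx m n s1 aOUT k = A k by rewrite -E1 read_mx_exec.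
have r1 : ints s1 vRHO 0 = n by rewrite -E1 setv_ints /=; case: cs => [[]].
pose I t st := [/\ ctx st, forall k, read_mx m n st aOUT k = A k,
   forall k, (k < t)%N -> ints st vRK k = \rank (A k),
   forall k, (k < t)%N -> (ints st vRHO 0 <= \rank (A k))%N &
   ints st vRHO 0 = n \/ exists2 k, (k < t)%N & \rank (A k) = ints st vRHO 0].
set body := seqc _.
have : I p (exec rt (CFor vK nP body) s1).
  have [[_ _ hp] _ _ _] := c1; have e1 : neval s1 nP = p by [].
  rewrite -[X in I X _]e1; apply: exec_for => [|t st _ It].
    by split=> //; left.
  have {It} : I t (tick 1 (set_int vK 0 t st)) by [].
  have : ints (tick 1 (set_int vK 0 t st)) vK 0 = t by [].
  move: (tick 1 _) => s2 t2 [c2 A2 rk2 le2 ex2]; rewrite /body exec_seqc /foldl.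
  have := rank_of_outputP c2 t2; rewrite A2.
  move E3: (exec rt rank_of_output s2) => s3 cnt3.
  have c3 : ctx s3 by rewrite -E3; apply: ctx_exec.
  have t3 : ints s3 vK 0 = t by rewrite -E3 exec_ints.
  have A3 k : read_mx m n s3 aOUT k = A k by rewrite -E3 read_mx_exec.
  have rk3 k : ints s3 vRK k = ints s2 vRK k by rewrite -E3 exec_ints.
  have rho3 : ints s3 vRHO 0 = ints s2 vRHO 0 by rewrite -E3 exec_ints.
  move E4: (exec rt (CNSet _ _ _) s3) => s4.
  have c4 : ctx s4 by rewrite -E4; apply: ctx_exec.
  have A4 k : read_mx m n s4 aOUT k = A k by rewrite -E4 read_mx_exec.
  have rk4 k : (k < t.+1)%N -> ints s4 vRK k = \rank (A k).
    rewrite ltnS leq_eqVlt => lk; rewrite -E4 /exec /= t3.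
    by case: eqP lk => [-> _|_ /= lk]; rewrite ?cnt3 // rk3 rk2.
  have rho4 : ints s4 vRHO 0 = ints s2 vRHO 0 by rewrite -E4 exec_ints.
  have cnt4 : ints s4 vCNT 0 = \rank (A t) by rewrite -E4 exec_ints.
  split.
  - exact: ctx_exec.
  - by move=> k; rewrite read_mx_exec.
  - by move=> k lk; rewrite exec_ints // rk4.
  - move=> k; rewrite /exec /= rho4 cnt4; case: (leqP (\rank (A t)) (ints s2 vRHO 0)) => h /=; rewrite ?rho4 ?cnt4.
      by rewrite ltnS leq_eqVlt => /orP[/eqP->//|/le2 h']; apply: leq_trans h h'.
    by rewrite ltnS leq_eqVlt => /orP[/eqP->|/le2 h'] //; apply: ltnW.
  - rewrite /exec /= rho4 cnt4; case: (leqP (\rank (A t)) (ints s2 vRHO 0)) => h /=; rewrite ?rho4 ?cnt4.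
      by right; exists t.
    by case: ex2 => [->|[k lk e]]; [left|right; exists k => //; apply: ltnW].
(* If rho is still n, the first matrix has rank at least n, hence exactly n, and attains it. *)
case=> _ _ h1 h2 h3; split=> //; case: h3 => // e; exists 0%N => //.
apply/eqP; rewrite eqn_leq h2 // andbT e; exact: rank_leq_col.
Qed.

Lemma selectP s : ctx s ->
  let L := [seq k <- iota 0 p | (ints s vRK k <= ints s vRHO 0)%N] in
  let s' := exec rt select s in
  [/\ ints s' 0 0 = ints s vRHO 0, ints s' vNUM 0 = size L &
    forall j, (j < size L)%N -> read_mx m n s' aMIN j = read_mx m n s aOUT (nth 0%N L j)].
Proof.
move=> cs L s'; rewrite /s' /select exec_seqc /foldl {s'}.
move E1: (exec rt (setv vNUM _) s) => s1.
have c1 : ctx s1 by rewrite -E1; apply: ctx_exec.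
pose Lt t := [seq k <- iota 0 t | (ints s vRK k <= ints s vRHO 0)%N].
pose I t st := [/\ ctx st, forall k, ints st vRK k = ints s vRK k,
   ints st vRHO 0 = ints s vRHO 0,
   forall k, read_mx m n st aOUT k = read_mx m n s aOUT k &
   ints st vNUM 0 = size (Lt t) /\
   forall j, (j < size (Lt t))%N -> read_mx m n st aMIN j = read_mx m n s aOUT (nth 0%N (Lt t) j)].
set body := CIf _ _ _.
have : I p (exec rt (CFor vK nP body) s1).
  have [[_ _ hp] _ _ _] := c1; have e1 : neval s1 nP = p by [].
  rewrite -[X in I X _]e1; apply: exec_for => [|t st lt It].
    split=> //=; last by rewrite -E1.
    - by move=> k; rewrite -E1 exec_ints.
    - by rewrite -E1 exec_ints.
    - by move=> k; rewrite -E1; apply: read_mx_exec.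
  have {lt} lt : (t < p)%N by rewrite -[X in (_ < X)%N]e1.
  have {It} : I t (tick 1 (set_int vK 0 t st)) by [].
  have : ints (tick 1 (set_int vK 0 t st)) vK 0 = t by [].
  move: (tick 1 _) => s2 t2 I2; rewrite /body exec_if.
  set k := (bcost _ _).+1; have {I2} : I t (tick k s2) by [].
  have : ints (tick k s2) vK 0 = t by [].
  have -> : beval s2 (BLeq (NGet vRK (nvar vK)) (nvar vRHO)) =
     beval (tick k s2) (BLeq (NGet vRK (nvar vK)) (nvar vRHO)) by [].
  move: (tick k s2) => {t2} s3 t3 [c3 rk3 rho3 A3 [N3 O3]].
  have LS : Lt t.+1 = Lt t ++ [seq k <- [:: t] | (ints s vRK k <= ints s vRHO 0)%N].
    by rewrite /Lt -(addn1 t) iotaD filter_cat add0n.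
  rewrite [beval _ _]/= t3 rk3 rho3; rewrite /= in LS; case: ifP => h; rewrite h in LS; last first.
    by rewrite cats0 in LS; split; rewrite ?LS.
  rewrite exec_seqc /foldl; move E4: (exec rt (tset _ _ _ _ _ _ _) s3) => s4.
  (* At most p matrices are selected and p + 1 is within the bound, so the counter is never
     truncated. *)
  have sz : (size (Lt t) < big_int m n p)%N.
    have [_ _ bp _ _] := @big_int_le m n p; apply: leq_trans bp; rewrite ltnS.
    rewrite size_filter; apply: leq_trans (count_size _ _) _; rewrite size_iota ltnW //.
  have N4 : ints s4 vNUM 0 = size (Lt t) by rewrite -E4 exec_ints.
  have B4 : ints s4 vBIG 0 = big_int m n p by rewrite -E4 exec_ints //; case: c3.
  split; try (by move=> *; rewrite ?exec_ints // -?E4 ?exec_ints // ?read_mx_exec // ?A3).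
  - by apply: ctx_exec => //; rewrite -E4; apply: ctx_exec.
  - rewrite LS size_cat [size [:: t]]/=; split.
      rewrite setv_ints -[LHS]/(neval s4 (clip (NAdd (nvar vNUM) (NCst 1)))) clipE /= N4 //.
      by rewrite B4 addn1.
    move=> j; rewrite addn1 ltnS leq_eqVlt read_mx_exec // nth_cat -E4 => /orP[/eqP->|lj].
      rewrite ltnn subnn /= -[X in read_mx _ _ _ _ X]N3 -[ints s3 vNUM 0]/(neval s3 (nvar vNUM)).
      have [[hm hn _] _ _ _] := c3.
      by rewrite tset_mx // -A3; apply/matrixP => u v; rewrite !mxE big_ord1 /loopst /= t3.
    by rewrite lj tset_other ?O3 //= N3 neq_ltn lj.
move: (exec rt _ s1) => s2 [_ _ rho2 _ [N2 O2]]; split=> //.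
Qed.

End Final.

(** [init_cmd] is kept apart because it creates the bound itself, by an unclipped product. *)
Lemma small_main_cmd : small_cmd main_cmd.
Proof. by []. Qed.

(** * Assembling the program *)

Section Correctness.
Variables (K : fieldType) (rt : {poly K} -> seq K).
Hypothesis rtP : root_finder rt.
Variables (m n p : nat) (V : {vspace 'M[K]_(m, n)}) (M Z : p.-tuple 'M[K]_(m, n)).
Hypothesis p0 : (0 < p)%N.
Hypothesis basisM : basis_of V M.
Hypothesis dir_col : directv (\sum_(i < p) Im (tnth M i))%VS.
Hypothesis dir_row : directv (\sum_(i < p) Im (tnth M i)^T)%VS.
Hypothesis basisZ : basis_of V Z.

Lemma init_ctx wd : ctx Z (exec rt init_cmd (input Z wd)).
Proof.
rewrite /init_cmd exec_seqc /foldl; split=> //.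
- by rewrite /exec /= addn1.
- move=> k; apply/matrixP => i j; rewrite mxE /exec /= !insubT //= => lk li lj.
  by congr (tnth Z _ _ _); apply: val_inj.
- move=> a b; rewrite /exec /=; case: (insub 0%N) => [?|]; case: a b => [|a] [|b] //=;
  case: insub => [?|] //; case: insub => //.
Qed.

Lemma main_correct s : ctx Z s -> correct_output V M (exec rt main_cmd s).
Proof.
move=> cs; rewrite /main_cmd exec_seqc /foldl.
have [] := relationsP rt cs; move: (exec rt relations s) => s1 c1 NX1 X1.
have [] := algebraP rt c1 NX1 X1; move: (exec rt algebra s1) => s2 c2 NG2 G2.
pose G := read_mx p p s2 aG; have tU := transition_unit basisM basisZ.
(* [preserves_relationsP] only asserts that weights exist; conjugating back gives them as a function
   of g. *)
pose w g : 'rV[K]_p := \row_i (invmx (transition M Z) *m G g *m transition M Z) i i.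
have pr := preserves_relationsP basisM dir_col dir_row basisZ.
have GE g : (g < p * p)%N -> G g = hdiag M Z (w g).
  move=> lg; have /G2/pr[ww e] : G g \in span_of G (p * p) by apply: mem_span_of.
  rewrite e; congr hdiag; apply/rowP => i; rewrite mxE e.
  by rewrite /hdiag !mulmxA mulVmx // mul1mx mulmxKV // mxE eqxx mulr1n.
have Gs ww : hdiag M Z ww \in span_of G (p * p) by apply/G2/pr; exists ww.
have gc : gctx Z G s2 by split.
have [sigma hs] := hidden_basisP rtP basisM basisZ GE Gs gc p0.
have : ctx Z (exec rt hidden_basis s2) by apply: ctx_exec.
move: (exec rt hidden_basis s2) hs => s3 hs c3.
have [] := min_rank_cmdP rt c3 p0.
have : ctx Z (exec rt min_rank s3) by apply: ctx_exec.
have : forall k, read_mx m n (exec rt min_rank s3) aOUT k = read_mx m n s3 aOUT k.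
  by move=> k; rewrite read_mx_exec.
move: (exec rt min_rank s3) => s4 A4 c4 rk4 le4 ex4.
have [] := selectP rt c4; set L := filter _ _.
have : forall k, read_mx m n (exec rt select s4) aOUT k = read_mx m n s3 aOUT k.
  by move=> k; rewrite read_mx_exec.
move: (exec rt select s4) => s5 A5 rho5 num5 min5.
set rho := ints s4 vRHO 0 in le4 ex4 rho5 L num5 min5.
pose A (k : 'I_p) := read_mx m n s3 aOUT k.
have Ale k : (rho <= \rank (A k))%N by apply: le4.
have Aex : exists k, \rank (A k) = rho by case: ex4 => k lk e; exists (Ordinal lk).
have memL k : (k \in L) = (k < p)%N && (\rank (read_mx m n s3 aOUT k) <= rho)%N.
  rewrite mem_filter mem_iota /= add0n andbC; case: ltnP => //= lk.
  by rewrite rk4.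
have nthL j : (j < size L)%N -> (nth 0%N L j < p)%N.
  by move=> lj; have := mem_nth 0%N lj; rewrite memL => /andP[].
have num : out_num s5 = size L by [].
split.
- by exists sigma => k; rewrite /out_basis A5; apply: hs.
- rewrite /out_rho rho5; exact: (min_rankP basisM dir_col hs Ale Aex).
- move=> X XV; rewrite /out_rho rho5.
  apply: iff_trans (min_rank_unique basisM dir_col dir_row hs Ale Aex XV) _.
  split=> [[k [rk [a a0 e]]]|[l [a a0 e]]].
    have kL : (k : nat) \in L by rewrite memL ltn_ord.
    have lt : (index (k : nat) L < out_num s5)%N by rewrite num index_mem.
    exists (Ordinal lt), a => //; rewrite /out_minrank min5 /= ?index_mem // nth_index //.
    by rewrite A4.
  have ll : (l < size L)%N by rewrite -num.
  exists (Ordinal (nthL _ ll)); split.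
    by have := mem_nth 0%N ll; rewrite memL => /andP[].
  by exists a => //; rewrite e /out_minrank min5 // A4.
(* The default is never reached, as the entries of [L] are below p; injectivity holds because [L]
   has no repetition. *)
- exists (fun l => insubd (Ordinal p0) (nth 0%N L l)).
    move=> l1 l2 /(congr1 val); rewrite !val_insubd !nthL -?num // => /eqP.
    rewrite nth_uniq -?num // ?filter_uniq ?iota_uniq // => /eqP; exact: val_inj.
  move=> l; have ll : (l < size L)%N by rewrite -num.
  by rewrite /out_minrank min5 // /out_basis A5 val_insubd nthL // A4.
Qed.

End Correctness.

Lemma program_clock (K : fieldType) : exists c d : nat,
  forall rt : {poly K} -> seq K, root_finder rt ->
  forall m n p (Z : p.-tuple 'M[K]_(m, n)) wd, (0 < p)%N ->
  (clock (exec rt (CSeq init_cmd main_cmd) (input Z wd)) <= c * (m + n + p) ^ d)%N.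
Proof.
have [k Hk] := small_cmd_clock K small_main_cmd.
have [i Hi] := ncost_bound K (NMul (NAdd (NAdd (NAdd nM nN) nP) (NCst 1))
  (NAdd (NAdd (NAdd nM nN) nP) (NCst 1))).
move: Hi; set e := NMul _ _ => Hi.
(* Initialisation costs at most B^i + 15 and the rest at most B^k, in all at most 17 B^(i+k). With S
   = m + n + p positive, B = (S + 1)^2 is at most 4 S^2. *)
exists (17 * 4 ^ (i + k))%N, (2 * (i + k))%N => rt rtP m n p Z wd p0.
have [bm bn bp _ _] := big_int_le m n p; set B := big_int m n p in bm bn bp.
have B2 : (1 < B)%N by apply: leq_trans bp.
have in_le : ints_le B (input Z wd).
  move=> x y /=; case: ifP => // _; case: x => [|[|[|x]]] //=; first exact: ltnW.
  by rewrite nth_nil.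
have [[h1 h2 h3] h4 _ _] := init_ctx rt Z wd.
pose s1 := exec rt (seqc [:: CNSet 0 (NCst 1) (nvar 1); CNSet 0 (NCst 2) (nvar 2)]) (input Z wd).
have s1_le : ints_le B s1.
  have i1 := set_int_le 0 1 (in_le 1%N 0%N) in_le.
  move=> x y; exact: (set_int_le 0 2 (i1 2%N 0%N) i1 x y).
have s_le : ints_le B (exec rt init_cmd (input Z wd)).
  move=> x y; have [/andP[/eqP-> /eqP->]|h] := boolP ((x == vBIG) && (y == 0%N)).
    by rewrite h4.
  suff -> : ints (exec rt init_cmd (input Z wd)) x y = ints s1 x y by [].
  by rewrite /init_cmd exec_seqc /foldl exec_ints // setv_ints (negbTE h).
rewrite exec_seq; have [_ le] := Hk rt B _ rtP B2 s_le; apply: leq_trans le _.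
have {}Hi := Hi B _ B2 s1_le.
have -> : clock (exec rt init_cmd (input Z wd)) = (ncost s1 e + 15)%N.
  rewrite /init_cmd exec_seqc /foldl -/e.
  transitivity (clock s1 + (1 + ncost s1 e).+1 + 5)%N; first by [].
  have -> : clock s1 = 8%N by [].
  move: (ncost s1 e) => N.
  by rewrite -[(1 + _).+1]addn1 [(1 + _)%N]addnC !addnA [(8 + _)%N]addnC -!addnA.
have Bik : (B ^ i + 15 + B ^ k <= 17 * B ^ (i + k))%N.
  have a1 : (B ^ i <= B ^ (i + k))%N by rewrite leq_pexp2l ?leq_addr // ltnW.
  have a2 : (B ^ k <= B ^ (i + k))%N by rewrite leq_pexp2l ?leq_addl // ltnW.
  have a3 : (1 <= B ^ (i + k))%N by rewrite expn_gt0 ltnW.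
  rewrite -[17%N]/(1 + 15 + 1)%N !mulnDl !mul1n leq_add // leq_add //.
  by rewrite -[X in (X <= _)%N]muln1 leq_mul.
apply: leq_trans (leq_trans _ Bik) _; first by rewrite !leq_add2r.
rewrite -mulnA leq_mul2l /= expnM -expnMn.
have leB : (B <= 4 * (m + n + p) ^ 2)%N.
  rewrite -[4%N]/(2 ^ 2)%N -expnMn leq_exp2r // mul2n -addnn -[X in (X <= _)%N]addn1.
  by rewrite leq_add2l addn_gt0 p0 orbT.
by case: (i + k)%N => [|a]; rewrite ?expn0 // leq_exp2r.
Qed.

Theorem theorem1p6 (K : fieldType) :
  exists (prog : cmd) (c d : nat),
  forall rt : {poly K} -> seq K, root_finder rt ->
  forall (m n p : nat) (V : {vspace 'M[K]_(m, n)})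
         (M Z : p.-tuple 'M[K]_(m, n)),
    (0 < p)%N ->
    basis_of V M ->
    directv (\sum_(i < p) Im (tnth M i))%VS ->
    directv (\sum_(i < p) Im (tnth M i)^T)%VS ->
    basis_of V Z ->
    let T := (c * (m + n + p) ^ d)%N in
    (forall w : T.-tuple bool, (clock (exec rt prog (input Z w)) <= T)%N) /\
    prob_ge (2%:R / 3%:R)
      (fun w : T.-tuple bool => correct_output V M (exec rt prog (input Z w))).
Proof.
have [c [d H]] := program_clock K; exists (CSeq init_cmd main_cmd), c, d.
move=> rt rtP m n p V M Z p0 bM dc dr bZ T; split=> [w|]; first exact: H.
(* Every sequence of coins leads to a correct output, so the frequency is 1. *)
exists setT => [|w _]; last first.
  by rewrite exec_seq; exact: (main_correct rtP p0 bM dc dr bZ (init_ctx rt Z w)).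
rewrite cardsT card_tuple card_bool divff; first by [].
by rewrite Num.Theory.pnatr_eq0 expn_eq0.
Qed.
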